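(* Let $\mathcal{X}$ and $\mathcal{S}$ be finite sets, $X$ a random variable on $\mathcal{X}$ with $p_x=\Pr[X=x]$, $\mathcal{H}_B$ a finite-dimensional Hilbert space, and $\rho_{XB}=\sum_{x}p_x|x\rangle\langle x|\otimes\rho_x$ a classical-quantum state on $\mathcal{H}_X\otimes\mathcal{H}_B$ (where $\{|x\rangle\}$ is an orthonormal basis of $\mathcal{H}_X$ and $\rho_x$ are states on $\mathcal{H}_B$), with $\rho_B=\sum_x p_x\rho_x$. Let $\mathcal{G}$ be a two-universal family of functions $\mathcal{X}\to\mathcal{S}$ and $G$ a random variable, independent of $\rho_{XB}$, uniformly distributed over $\mathcal{G}$; let $S=G(X)$. Define $$\rho_{SGB}=\sum_{s\in\mathcal{S},g\in\mathcal{G}}p_{s|g}|s\rangle\langle s|\otimes\frac{1}{|\mathcal{G}|}|g\rangle\langle g|\otimes\rho_{s|g},\quad p_{s|g}=\sum_{x\in g^{-1}(s)}p_x,\quad \rho_{s|g}=\frac{1}{p_{s|g}}\sum_{x\in g^{-1}(s)}p_x\rho_x,$$ and $\sigma_{SGB}=\frac{1}{|\mathcal{S}|}\mathbb{I}_S\otimes\frac{1}{|\mathcal{G}|}\mathbb{I}_G\otimes\rho_B$. Then for every $\epsilon\ge 0$, $$D(\rho_{SGB}\,\|\,\sigma_{SGB})\le \epsilon\log_2(d|\mathcal{S}|)+\eta_0(\epsilon)+\frac{\delta+\epsilon+\epsilon^{1/2}}{\ln 2},$$ where $d=\mathrm{rank}\,\rho_B$, $\delta=|\mathcal{S}|\,2^{-R_\epsilon(X|B)_\rho}$,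 and $\eta_0(\epsilon)=-\epsilon\log_2\epsilon$ for $0\le\epsilon\le 1/2$, $\eta_0(\epsilon)=1/2$ for $\epsilon>1/2$.
   Context: A family $\mathcal{G}$ of functions $\mathcal{X}\to\mathcal{S}$ is two-universal if, for $G$ uniform on $\mathcal{G}$, $\Pr[G(x_0)=G(x_1)]\le 1/|\mathcal{S}|$ for all distinct $x_0,x_1\in\mathcal{X}$. The relative entropy is $D(A\|B)=\mathrm{Tr}[A(\log_2A-\log_2B)]$ (with $0\log_2 0=0$). For a Hermitian operator $Y=\sum_i\lambda_iE_i$, $\{Y\le0\}=\sum_{i:\lambda_i\le0}E_i$. For the state $\rho_{XB}$, with $\rho^{(2)}_B=\mathrm{Tr}_X[\rho_{XB}^2]$, the information spectrum collision entropy is $$R_\epsilon(X|B)_\rho=\sup\big\{\lambda:\mathrm{Tr}\big[\{\rho^{(2)}_B-2^{-\lambda}\rho_B^2\le0\}\rho_B\big]\ge1-\epsilon\big\}.$$ *)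

(* Defs.v *)
From HB Require Import structures.
From mathcomp Require Import all_boot all_order all_algebra.
From mathcomp Require Import complex mxtens.
From mathcomp Require Import classical_sets reals ereal exp.

Set Implicit Arguments.
Unset Strict Implicit.
Unset Printing Implicit Defensive.

Import Order.TTheory GRing.Theory Num.Theory.
Local Open Scope ring_scope.
Local Open Scope complex_scope.

Section QDefs.
Variable R : realType.
Local Notation C := R[i].

Definition log2 (x : R) : R := if 0 < x then ln x / ln 2 else 0.

Definition mxfun n (f : R -> R) (A : 'M[C]_n) : 'M[C]_n :=
  invmx (spectralmx A) *m
  diag_mx (map_mx (fun z : C => (f (complex.Re z))%:C) (spectral_diag A)) *m
  spectralmx A.

Definition mlog2 n (A : 'M[C]_n) := mxfun log2 A.

Definition relent n (A B : 'M[C]_n) : R :=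
  complex.Re (\tr (A *m (mlog2 A - mlog2 B))).

Definition nonpos_proj n (Y : 'M[C]_n) : 'M[C]_n :=
  mxfun (fun l => if l <= 0 then 1 else 0) Y.

Definition psdmx n (A : 'M[C]_n) : Prop :=
  forall v : 'rV[C]_n, 0 <= (v *m A *m (map_mx Num.conj v)^T) 0 0.

Definition density n (A : 'M[C]_n) : Prop := psdmx A /\ \tr A = 1.

Definition ket_proj (T : finType) (t : T) : 'M[C]_#|T| :=
  delta_mx (enum_rank t) (enum_rank t).

Definition ptrace1 m n (M : 'M[C]_(m * n)) : 'M[C]_n :=
  \matrix_(j, k) \sum_(i < m) M (mxtens_index (i, j)) (mxtens_index (i, k)).

Definition Rcoll m n (eps : R) (rhoXB : 'M[C]_(m * n)) (rhoB : 'M[C]_n) : \bar R :=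
  let rho2 := ptrace1 (rhoXB *m rhoXB) in
  ereal_sup [set (l%:E)%E | l in
    [set l : R | 1 - eps <=
       complex.Re (\tr (nonpos_proj (rho2 - (2 `^ (- l))%:C *: (rhoB *m rhoB)) *m rhoB))]].

Definition pow2e (r : \bar R) : \bar R :=
  match r with
  | EFin x => EFin (2 `^ x)
  | EPInf => @EPInf R
  | ENInf => EFin 0
  end.

Definition two_universal (X S G : finType) (gf : G -> {ffun X -> S}) : Prop :=
  forall x0 x1 : X, x0 != x1 ->
    (#|[set g | gf g x0 == gf g x1]|%:R / #|G|%:R : R) <= 1 / #|S|%:R.

Definition eta0 (eps : R) : R := if eps <= 1/2 then - eps * log2 eps else 1/2.

End QDefs.
Arguments ket_proj {R T} t.

(* Main.v *)
(** Put [w s g = \sum_(g x = s) p_x rho_x].  Block-diagonality turns the relative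
    entropy (in nats) into
      ln |S| + E_g (\sum_s Tr (w s g) ln (w s g)) - Tr rhoB ln rhoB.
    Fix an admissible [lambda], let [P] be its projection, [e = 1 - Tr P rhoB <= eps],
    and choose an orthonormal basis adapted to [P], with index set [J] for the range
    of [P], which diagonalises [P rhoB^2 P] with eigenvalues [z_j].  Klein's inequality
    replaces [ln rhoB] by the logarithm of the operator that is diagonal in this basis
    with entries [y_j = sqrt z_j] on [J] and [e / rank rhoB] elsewhere.  For an
    eigenvector of [w s g] with eigenvalue [a <= 1], Jensen's inequality for [ln] at the
    points [y_j^(-1/2)], [j] in [J], and [ln x <= x - 1] bound what is left by the
    sandwiched collision term [Tr (w N w N)], [N = diag (y_j^(-1/2))] on [J], plus
    terms linear in [e].  The form [Tr (A N B N)] is nonnegative on positive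
    operators, so two-universality applies to it, and [Tr (A N A N) <= Tr (N^2 A^2)]
    brings in [P rho2 P <= 2^(-lambda) P rhoB^2 P].  The term [sqrt eps] comes from
    [(\sum_J sqrt z_j)^2 <= Tr P rhoB].  To keep all logarithms finite, [y] is shifted
    by a [k > 0] which is sent to [0] at the end. *)

Require Import Defs.
From HB Require Import structures.
From mathcomp Require Import all_boot all_order all_algebra.
From mathcomp Require Import complex mxtens.
From mathcomp Require Import classical_sets reals ereal exp.
From mathcomp Require Import ring lra.
Import Order.TTheory GRing.Theory Num.Theory.
Set Implicit Arguments.
Unset Strict Implicit.
Unset Printing Implicit Defensive.
Local Open Scope ring_scope.
Local Open Scope complex_scope.

Reserved Notation "A ^h" (at level 8, format "A ^h").

(** * Scalar inequalities for the logarithm and for [eta0] *)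

Section Scalar.
Variable R : realType.
Implicit Types x a t : R.

Lemma ln_le_subr1 x : 0 < x -> ln x <= x - 1.
Proof.
move=> x0.
have := @le_ln1Dx R (x - 1); rewrite (_ : 1 + (x - 1) = x); last by ring.
by apply; lra.
Qed.

(* This is [x ln (y / x) <= y - x] in a form that allows [x = 0]. *)
Lemma mul_ln_le x y : 0 <= x -> 0 < y -> x * ln y <= x * ln x + (y - x).
Proof.
rewrite le_eqVlt => /orP[/eqP <- y0|x0 y0]; first by rewrite !mul0r; lra.
have := ln_le_subr1 (divr_gt0 y0 x0); rewrite ln_div ?posrE// => h.
have := ler_wpM2l (ltW x0) h; rewrite !mulrBr mulr1 [x * (y / x)]mulrC divfK ?gt_eqF//.
by lra.
Qed.

Lemma ln_le_pos x y : 0 < x -> x <= y -> ln x <= ln y.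
Proof. by move=> x0 xy; rewrite ler_ln// posrE// (lt_le_trans x0). Qed.

(** In the application [a] is an eigenvalue and [w] lists the squared overlaps of its eigenvector
    with the basis. The terms in [ln yQ] cancel, and [a <= 1] discards [(1 - pJ) ln a]. After Jensen
    on [J] there remains [pJ ln (t a c^2) - 2 pJ ln pJ]; two uses of [mul_ln_le] bound it by
    [(t a c^2 - pJ) + (1 - pJ)]. *)
Lemma scaled_jensen (I : finType) (J : pred I) (w y : I -> R) a t yQ :
  (forall i, 0 <= w i) -> \sum_i w i = 1 -> 0 <= a <= 1 -> 0 < t ->
  (forall i, 0 < y i) -> (forall i, ~~ J i -> y i = yQ) ->
  a * ln a - a * \sum_i w i * ln (y i) <=
    t * (a ^+ 2 * (\sum_(i | J i) w i * (Num.sqrt (y i))^-1) ^+ 2)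
    - a * (\sum_(i | J i) w i) * (1 + ln t)
    + a * (1 - \sum_(i | J i) w i) * (1 - ln yQ).
Proof.
move=> w0 w1 /andP[a0 a1] t0 y0 yq.
set pJ := \sum_(i | J i) w i; set c := \sum_(i | J i) _ / _.
move: a0; rewrite le_eqVlt => /orP[/eqP <-|a0].
  by rewrite expr0n /= !mul0r !mulr0; lra.
have pJ0 : 0 <= pJ by apply: sumr_ge0.
have wsplit : \sum_(i | ~~ J i) w i = 1 - pJ.
  by move: w1; rewrite (bigID J) /= -/pJ; lra.
have q0 : 0 <= 1 - pJ by rewrite -wsplit; apply: sumr_ge0.
have -> : \sum_i w i * ln (y i) =
    \sum_(i | J i) w i * ln (y i) + (1 - pJ) * ln yQ.
  rewrite (bigID J) /=; congr (_ + _); rewrite -wsplit mulr_suml.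
  by apply: eq_bigr => i /yq ->.
set L := \sum_(i | J i) w i * ln (y i).
suff main : pJ * ln a - L + pJ * ln t <= t * a * c ^+ 2 + 1 - 2 * pJ.
  have lna : ln a <= 0 by apply: ln_le0.
  have h1 : (1 - pJ) * ln a <= 0 by apply: mulr_ge0_le0.
  have h2 : ln a - L + pJ * ln t <= t * a * c ^+ 2 + 1 - 2 * pJ by lra.
  have := ler_wpM2l (ltW a0) h2.
  set A := ln a; set T := ln t; set Q := ln yQ.
  by rewrite expr2; move=> h3; nra.
(* The tangent at [c / pJ] requires [pJ] to be nonzero, so an eigenvector without weight on [J] is
   treated apart. *)
have [pJ00|pJn0] := eqVneq pJ 0.
  have wJ i : J i -> w i = 0.
    by move=> Ji; have /psumr_eq0P : pJ = 0 by []; apply.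
  have -> : L = 0 by rewrite /L big1 // => i /wJ ->; rewrite mul0r.
  rewrite pJ00 !mul0r mulr0; have : 0 <= t * a * c ^+ 2 by rewrite mulr_ge0 ?sqr_ge0 // mulr_ge0 // ltW.
  by lra.
have pJgt : 0 < pJ by rewrite lt_neqAle eq_sym pJn0.
have sy i : 0 < (Num.sqrt (y i))^-1 by rewrite invr_gt0 sqrtr_gt0.
have cgt : 0 < c.
  have c0 : 0 <= c by apply: sumr_ge0 => i _; rewrite mulr_ge0 // ltW.
  rewrite lt_neqAle c0 andbT eq_sym; apply/negP => /eqP c00.
  have : pJ = 0.
    rewrite /pJ big1 // => i Ji.
    have /psumr_eq0P : c = 0 by [].
    move=> /(_ (fun i _ => mulr_ge0 (w0 i) (ltW (sy i)))) /(_ i Ji) /eqP.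
    by rewrite mulf_eq0 (gt_eqF (sy i)) orbF => /eqP.
  by move/eqP; rewrite (negbTE pJn0).
(* Jensen for the concave [ln] at the points [y_i^(-1/2)]: the tangent at their mean [c / pJ]. *)
have lnL : - L <= 2 * (pJ * ln (c / pJ)).
  have -> : 2 * (pJ * ln (c / pJ)) =
     \sum_(i | J i) w i * (2 * (ln (c / pJ) + ((Num.sqrt (y i))^-1 / (c / pJ) - 1))).
    transitivity (2 * (\sum_(i | J i) (w i * ln (c / pJ) + (w i * (Num.sqrt (y i))^-1 * (pJ / c) - w i)))).
      rewrite big_split /= sumrB -!mulr_suml -/pJ -/c.
      by rewrite [c * (pJ / c)]mulrC divfK ?gt_eqF // subrr addr0.
    rewrite mulr_sumr; apply: eq_bigr => i _; rewrite invf_div; ring.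
  rewrite /L -sumrN; apply: ler_sum => i Ji.
  rewrite -mulrN; apply: ler_wpM2l => //.
  have cp : 0 < c / pJ by rewrite divr_gt0.
  have := ln_le_subr1 (divr_gt0 (sy i) cp).
  rewrite ln_div ?posrE // lnV ?posrE ?sqrtr_gt0 //.
  have -> : ln (y i) = 2 * ln (Num.sqrt (y i)).
    rewrite -{1}[y i]sqr_sqrtr ?ltW // expr2 lnM ?posrE ?sqrtr_gt0 //; ring.
  by lra.
have t1 : 0 < t * a * c ^+ 2 by rewrite !mulr_gt0 // exprn_gt0.
have e1 : ln (t * a * c ^+ 2) = ln t + ln a + 2 * ln c.
  rewrite expr2 !lnM ?posrE ?mulr_gt0 //; ring.
have := mul_ln_le (ltW pJgt) t1; rewrite e1 => h1.
have e2 : ln (c / pJ) = ln c - ln pJ by rewrite ln_div ?posrE.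
have := mul_ln_le (ltW pJgt) ltr01; rewrite ln1 mulr0 => h2.
move: lnL; rewrite e2 => lnL.
rewrite !mulrDr in h1; rewrite mulrBr in lnL.
by lra.
Qed.

(** The derivative of [x - x ln x] is [- ln x], nonnegative up to [1]. The tangent inequality
    [mul_ln_le] and [ln y <= 0] stand in for the derivative. *)
Lemma eta_nat_le x y : 0 <= x -> x <= y -> y <= 1 ->
  - (x * ln x) + x <= - (y * ln y) + y.
Proof.
move=> x0; rewrite le_eqVlt => /orP[/eqP -> //|xy y1].
have y0 : 0 < y by apply: le_lt_trans x0 xy.
have := mul_ln_le x0 y0 => h.
have lny : ln y <= 0 by apply: ln_le0.
have : (y - x) * ln y <= 0 by apply: mulr_ge0_le0 => //; lra.
by lra.
Qed.

(** With [A = 1 - e] and [b > A], one has [b - A <= b (1 - b) <= 1/4], hence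
    [4 (b - A)^2 <= b - A <= 1 - A = e]. *)
Lemma sqrt_defect_le (b e : R) : 0 <= e <= 1 -> 0 <= b -> b ^+ 2 <= 1 - e ->
  2 * (b - (1 - e)) <= Num.sqrt e.
Proof.
move=> /andP[e0 e1] b0 b2.
have [hle|hgt] := lerP (b - (1 - e)) 0.
  by apply: le_trans (sqrtr_ge0 _); lra.
rewrite -(@ler_pXn2r _ 2) ?nnegrE ?sqrtr_ge0 //; last by lra.
rewrite sqr_sqrtr //.
suff : 4 * (b - (1 - e)) ^+ 2 <= e by rewrite exprMn; lra.
set A := 1 - e; have eA : e = 1 - A by rewrite /A; ring.
have A0 : 0 <= A by rewrite /A; lra.
have A1 : A <= 1 by rewrite /A; lra.
rewrite -/A in b2 hgt; rewrite eA; clearbody A; clear eA e0 e1.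
have b1 : b <= 1 by nra.
have h1 : (b - A) <= b - b ^+ 2 by lra.
have h2 : 4 * (b - A)^+2 <= 4 * ((b - b ^+ 2) * (b - A)).
  rewrite expr2; have : 0 <= b - A by lra.
  by move=> h; have := ler_wpM2r h h1; lra.
apply: le_trans h2 _.
have h3 : 4 * (b * (1 - b)) <= 1 by have := sqr_ge0 (2 * b - 1); rewrite !expr2; lra.
have h4 : 4 * ((b - b ^+ 2) * (b - A)) <= b - A.
  have -> : 4 * ((b - b ^+ 2) * (b - A)) = (4 * (b * (1 - b))) * (b - A) by ring.
  by apply: ler_piMl => //; lra.
by lra.
Qed.

Lemma ln2_gt0 : 0 < ln (2 : R).
Proof. by apply: ln_gt0; lra. Qed.

(** By itself [- x ln x] decreases after [1/e], before [eta0] becomes constant at [1/2]; the added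
    linear term restores monotonicity. For [x > 1/2] the tangent at [1/2] and [ln 2 <= 1]
    suffice. *)
Lemma eta0_mono (x eps : R) : 0 <= x <= 1 -> x <= eps ->
  - (x * ln x) + x <= ln 2 * eta0 eps + eps.
Proof.
move=> /andP[x0 x1] xe; rewrite /eta0 /log2.
have l2 := ln2_gt0; have l2n : ln 2 != 0 :> R by rewrite gt_eqF.
have e0 : 0 <= eps by apply: le_trans xe.
have [he|he] := lerP eps (1 / 2).
  case: ltrP => e0'.
    have -> : ln 2 * (- eps * (ln eps / ln 2)) = - (eps * ln eps) by field.
    by apply: eta_nat_le => //; lra.
  have xx : x = 0 by lra.
  have -> : eps = 0 by lra.
  by rewrite xx !mul0r; lra.
have lh : ln (1 / 2 : R) = - ln 2 by rewrite div1r lnV ?posrE //; lra.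
have [xh|xh] := lerP x (1 / 2).
  have := @eta_nat_le x (1/2) x0 xh; rewrite lh => h.
  have {}h := h ltac:(lra); lra.
have := @mul_ln_le x (1/2) x0 ltac:(lra); rewrite lh.
have := @ln_le_subr1 2 ltac:(lra) => l21 h.
have : (x - 1/2) * ln 2 <= (x - 1/2) * 1 by apply: ler_wpM2l; lra.
by lra.
Qed.

End Scalar.

(** * The spectral theorem for Hermitian matrices *)

Section HermitianSpectral.
Local Open Scope sesquilinear_scope.

Lemma hermitian_spectral (C : numClosedFieldType) n (A : 'M[C]_n) : A^t* = A ->
  [/\ spectralmx A *m (spectralmx A)^t* = 1%:M,
      invmx (spectralmx A) = (spectralmx A)^t*,
      A = (spectralmx A)^t* *m diag_mx (spectral_diag A) *m spectralmx A &
      forall i, spectral_diag A 0 i \is Num.real].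
Proof.
move=> hA; have Ah : A \is hermsymmx.
  by apply/is_hermitianmxP; rewrite expr0 scale1r hA.
have uS := spectral_unitarymx A.
split.
- exact/unitarymxP.
- exact: invmx_unitary.
- by have /orthomx_spectralP {1}-> := hermitian_normalmx Ah; rewrite invmx_unitary.
- by move=> i; move/mxOverP: (hermitian_spectral_diag_real Ah).
Qed.

End HermitianSpectral.

(** * Real parts and squared moduli of complex numbers *)

Section RealPart.
Variable R : realType.
Local Notation C := R[i].

Lemma ReD (x y : C) : complex.Re (x + y) = complex.Re x + complex.Re y.
Proof. by case: x; case: y. Qed.

Lemma ReN (x : C) : complex.Re (- x) = - complex.Re x.
Proof. by case: x. Qed.

Lemma ReZ (r : R) (x : C) : complex.Re (r%:C * x) = r * complex.Re x.
Proof. by case: x => a b /=; rewrite mul0r subr0. Qed.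

Lemma Re_sum (I : Type) (s : seq I) (P : pred I) (F : I -> C) :
  complex.Re (\sum_(i <- s | P i) F i) = \sum_(i <- s | P i) complex.Re (F i).
Proof. by apply: (big_morph _ ReD). Qed.

Lemma realC_sum (I : Type) (s : seq I) (P : pred I) (F : I -> R) :
  (\sum_(i <- s | P i) F i)%:C = \sum_(i <- s | P i) (F i)%:C :> C.
Proof. exact: rmorph_sum. Qed.

Lemma Re_ge0 (x : C) : 0 <= x -> 0 <= complex.Re x.
Proof. by rewrite lecE => /andP[]. Qed.

Definition nsq (z : C) : R := complex.Re (z * conjc z).

Lemma nsqE (z : C) : z * conjc z = (nsq z)%:C.
Proof.
rewrite /nsq.
case: z => a b /=; congr (_ +i* _); ring.
Qed.

Lemma nsq_ge0 (z : C) : 0 <= nsq z.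
Proof. by apply: Re_ge0; apply: mulcJ_ge0. Qed.

Lemma nsq_conj (z : C) : nsq (conjc z) = nsq z.
Proof. by rewrite /nsq conjcK mulrC. Qed.

End RealPart.

(** * Adjoints, eigendecompositions, functional calculus and positive operators *)

Section Adjoint.
Variable R : realType.
Local Notation C := R[i].

Definition hadj m n (A : 'M[C]_(m, n)) : 'M[C]_(n, m) := map_mx conjc A^T.
Local Notation "A ^h" := (hadj A).

Lemma hermitian_spectralC n (A : 'M[C]_n) : A^h = A ->
  [/\ spectralmx A *m (spectralmx A)^h = 1%:M,
      invmx (spectralmx A) = (spectralmx A)^h,
      A = (spectralmx A)^h *m diag_mx (spectral_diag A) *m spectralmx A &
      forall i, spectral_diag A 0 i \is Num.real].
Proof. exact: hermitian_spectral. Qed.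

Lemma hadjK m n (A : 'M[C]_(m, n)) : A^h^h = A.
Proof. by apply/matrixP => i j; rewrite !mxE conjcK. Qed.

Definition unitary n (U : 'M[C]_n) : Prop := U *m U^h = 1%:M.

Lemma hadjM m n p (A : 'M[C]_(m, n)) (B : 'M[C]_(n, p)) :
  (A *m B)^h = B^h *m A^h.
Proof. by rewrite /hadj trmx_mul map_mxM. Qed.

Lemma hadjD m n (A B : 'M[C]_(m, n)) : (A + B)^h = A^h + B^h.
Proof. by rewrite /hadj linearD /= map_mxD. Qed.

Lemma hadjB m n (A B : 'M[C]_(m, n)) : (A - B)^h = A^h - B^h.
Proof. by rewrite /hadj linearB /= map_mxB. Qed.

Lemma hadjZ m n (r : R) (A : 'M[C]_(m, n)) : (r%:C *: A)^h = r%:C *: A^h.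
Proof. by rewrite /hadj linearZ /= map_mxZ; congr (_ *: _); apply: conjc_real. Qed.

Lemma hadj_scalar1 n : (1%:M : 'M[C]_n)^h = 1%:M.
Proof. by rewrite /hadj trmx1 map_mx1. Qed.

Lemma hadj_sum (I : Type) (s : seq I) (P : pred I) m n (F : I -> 'M[C]_(m, n)) :
  (\sum_(i <- s | P i) F i)^h = \sum_(i <- s | P i) (F i)^h.
Proof. by apply: (big_morph _ (@hadjD m n)); rewrite /hadj linear0 map_mx0. Qed.

Lemma hadjE m n (A : 'M[C]_(m, n)) i j : (A^h) i j = conjc (A j i).
Proof. by rewrite !mxE. Qed.

Lemma unitary_mulVr n (U : 'M[C]_n) : unitary U -> U^h *m U = 1%:M.
Proof. exact: mulmx1C. Qed.

Lemma unitary_adj n (U : 'M[C]_n) : unitary U -> unitary U^h.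
Proof. by move=> uU; rewrite /unitary hadjK unitary_mulVr. Qed.

Lemma unitaryM n (U V : 'M[C]_n) : unitary U -> unitary V -> unitary (U *m V).
Proof.
move=> uU uV; rewrite /unitary hadjM mulmxA -(mulmxA U) uV mulmx1.
exact: uU.
Qed.

Lemma unitary_conjM n (A B V : 'M[C]_n) : unitary V ->
  V *m (A *m B) *m V^h = (V *m A *m V^h) *m (V *m B *m V^h).
Proof.
by move=> uV; rewrite !mulmxA -[V *m A *m V^h *m V]mulmxA (unitary_mulVr uV) mulmx1.
Qed.

Definition rdiag n (a : 'I_n -> R) : 'M[C]_n := diag_mx (\row_i (a i)%:C).

Lemma rdiagE n (a : 'I_n -> R) i j : rdiag a i j = (a i *+ (i == j))%:C.
Proof. by rewrite !mxE; case: eqP => _; rewrite ?mulr1n ?mulr0n. Qed.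

Lemma hadj_rdiag n (a : 'I_n -> R) : (rdiag a)^h = rdiag a.
Proof.
apply/matrixP => i j; rewrite hadjE !rdiagE.
have -> : (a j *+ (j == i)) = (a i *+ (i == j)).
  by rewrite eq_sym; case: eqP => // ->.
exact: conjc_real.
Qed.

Lemma rdiag_mulE n p (a : 'I_n -> R) (A : 'M[C]_(n, p)) i j :
  (rdiag a *m A) i j = (a i)%:C * A i j.
Proof. by rewrite mul_diag_mx !mxE. Qed.

Lemma mul_rdiagE n p (a : 'I_n -> R) (A : 'M[C]_(p, n)) i j :
  (A *m rdiag a) i j = A i j * (a j)%:C.
Proof. by rewrite mul_mx_diag !mxE. Qed.

Lemma rdiagM n (a b : 'I_n -> R) :
  rdiag a *m rdiag b = rdiag (fun i => a i * b i).
Proof.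
apply/matrixP => i j; rewrite rdiag_mulE !rdiagE -mulrnAr.
by rewrite -rmorphM.
Qed.

Lemma tr_rdiag n (a : 'I_n -> R) : \tr (rdiag a) = (\sum_i a i)%:C.
Proof.
by rewrite realC_sum; apply: eq_bigr => i _; rewrite rdiagE eqxx.
Qed.

(** A relation rather than a chosen decomposition: it passes to scaled, conjugated and
    block-diagonal matrices, whatever eigenbasis [spectralmx] would pick for them. *)
Definition eigdec n (A U : 'M[C]_n) (a : 'I_n -> R) :=
  unitary U /\ A = U^h *m rdiag a *m U.

Lemma eigdec_adj n (A U : 'M[C]_n) a : eigdec A U a -> A^h = A.
Proof.
by case=> _ ->; rewrite !hadjM hadjK hadj_rdiag mulmxA.
Qed.

Definition eigvals n (A : 'M[C]_n) (i : 'I_n) : R :=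
  complex.Re (spectral_diag A 0 i).

Lemma eigdec_spectral n (A : 'M[C]_n) : A^h = A ->
  eigdec A (spectralmx A) (eigvals A).
Proof.
move=> hA; have [uS _ AE rA] := hermitian_spectralC hA.
split=> //; rewrite {1}AE.
by congr (_ *m diag_mx _ *m _); apply/rowP => i; rewrite mxE RRe_real.
Qed.

(** This makes [mxfun] independent of the eigenbasis. The change of basis [W] intertwines the two
    diagonal matrices, so a nonzero entry [W i j] forces the eigenvalues [i] and [j] to agree, and
    then so do their images under [f]. *)
Lemma mxfun_eigdec n (A U : 'M[C]_n) a (f : R -> R) : eigdec A U a ->
  mxfun f A = U^h *m rdiag (f \o a) *m U.
Proof.
move=> eA; have [uU AE] := eA.
have [uS iS sA _] := hermitian_spectralC (eigdec_adj eA).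
rewrite /mxfun iS; set S := spectralmx A in uS sA *; clearbody S.
set W := S *m U^h.
have hW : diag_mx (spectral_diag A) *m W = W *m rdiag a.
  have SA : S *m A = diag_mx (spectral_diag A) *m S.
    by rewrite {1}sA !mulmxA uS mul1mx.
  by rewrite /W !mulmxA -SA {1}AE !mulmxA -[_ *m U *m _]mulmxA uU mulmx1.
set F := diag_mx _.
have hF : F *m W = W *m rdiag (f \o a).
  apply/matrixP => i j; rewrite mul_rdiagE mul_diag_mx.
  have /matrixP /(_ i j) := hW; rewrite mul_rdiagE mul_diag_mx mxE => h.
  rewrite mxE [X in X * _]mxE.
  have [->|W0] := eqVneq (W i j) 0; first by rewrite mulr0 mul0r.
  have -> : spectral_diag A 0 i = (a j)%:C.
    by apply: (mulIf W0); rewrite h mulrC.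
  by rewrite mulrC.
rewrite -[LHS]mulmx1 -(unitary_mulVr uU) !mulmxA.
rewrite -[_ *m F *m S *m _]mulmxA -[_ *m F *m _]mulmxA -/W hF.
by rewrite !mulmxA (unitary_mulVr uS) mul1mx.
Qed.

Lemma eigdec_conj n (A U V : 'M[C]_n) a : unitary V -> eigdec A U a ->
  eigdec (V *m A *m V^h) (U *m V^h) a.
Proof.
move=> uV [uU ->]; split; first by apply: unitaryM => //; apply: unitary_adj.
by rewrite hadjM hadjK !mulmxA.
Qed.

Lemma eigdecZ n (A U : 'M[C]_n) a r : eigdec A U a ->
  eigdec (r%:C *: A) U (fun i => r * a i).
Proof.
case=> uU ->; split => //; rewrite scalemxAl scalemxAr; congr (_ *m _).
congr (_ *m _); apply/matrixP => i j.
by rewrite mxE !rdiagE -rmorphM /= mulrnAr.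
Qed.

Lemma tr_mul_eigdec n (A U : 'M[C]_n) a (h : 'I_n -> R) : eigdec A U a ->
  \tr (A *m (U^h *m rdiag h *m U)) = (\sum_i a i * h i)%:C.
Proof.
case=> uU ->; rewrite -!mulmxA (mulmxA U) uU mul1mx mxtrace_mulC.
by rewrite -!mulmxA uU mulmx1 rdiagM tr_rdiag.
Qed.

Lemma tr_eigdec n (A U : 'M[C]_n) a : eigdec A U a -> \tr A = (\sum_i a i)%:C.
Proof.
case=> uU ->; rewrite mxtrace_mulC mulmxA uU mul1mx tr_rdiag //.
Qed.

Lemma diag_eigdec n (A U : 'M[C]_n) a j : eigdec A U a ->
  A j j = (\sum_i a i * nsq (U i j))%:C.
Proof.
case=> uU ->; rewrite mxE realC_sum; apply: eq_bigr => i _.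
by rewrite mul_rdiagE hadjE mulrC mulrA nsqE mulrC rmorphM.
Qed.

Lemma unitary_row_nsq n (U : 'M[C]_n) i : unitary U ->
  \sum_j nsq (U i j) = 1.
Proof.
move=> /matrixP/(_ i i); rewrite !mxE eqxx => h.
apply: (@complexI R); rewrite realC_sum -[RHS]h; apply: eq_bigr => j _.
by rewrite hadjE nsqE.
Qed.

Lemma unitary_col_nsq n (U : 'M[C]_n) j : unitary U ->
  \sum_i nsq (U i j) = 1.
Proof.
move=> /unitary_adj /(unitary_row_nsq j) <-.
by apply: eq_bigr => i _; rewrite hadjE nsq_conj.
Qed.

Lemma psdmxP n (A : 'M[C]_n) : psdmx A <->
  forall v : 'rV[C]_n, 0 <= (v *m A *m v^h) 0 0.
Proof. by split => h v; move: (h v); rewrite /hadj map_trmx. Qed.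

Lemma eigdec_diagE n (A U : 'M[C]_n) a i : eigdec A U a ->
  (U *m A *m U^h) i i = (a i)%:C.
Proof.
case=> uU ->; rewrite !mulmxA uU mul1mx -mulmxA uU.
by rewrite mulmx1 rdiagE eqxx.
Qed.

(** A nonnegative element of [R[i]] is real, so the quadratic form of [A] is real. The Hermitian
    matrix ['i *: (A - A^h)] then has zero quadratic form; its eigenvalues vanish, and so does
    it. *)
Lemma psd_adj n (A : 'M[C]_n) : psdmx A -> A^h = A.
Proof.
move/psdmxP => pA; set H := 'i *: (A - A^h).
have Hh : H^h = H.
  apply/matrixP => i j; rewrite !mxE; case: (A i j) (A j i) => [x y] [z w] /=.
  congr (_ +i* _); ring.
have eH := eigdec_spectral Hh; set U := spectralmx H in eH; set a := eigvals H in eH.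
have a0 i : a i = 0.
  apply: (@complexI R); rewrite -(eigdec_diagE i eH).
  have -> : (U *m H *m U^h) i i = (row i U *m H *m (row i U)^h) 0 0.
    by rewrite -row_mul !mxE; apply: eq_bigr => m _; rewrite !mxE.
  move: (row i U) => v; rewrite -scalemxAr -scalemxAl mulmxBr mulmxBl.
  have -> : v *m A^h *m v^h = (v *m A *m v^h)^h by rewrite !hadjM hadjK mulmxA.
  rewrite !mxE; have := pA v; rewrite mxE; move: (\sum_j _) => z.
  by rewrite lecE => /andP[/eqP]; case: z => x y /= ->; rewrite oppr0 subrr; move=> _; apply/eqP; rewrite eq_complex /= !mulr0 !subr0 !addr0 !eqxx.
have H0 : H = 0.
  case: eH => _ ->; have -> : rdiag a = 0.
    by apply/matrixP => i j; rewrite rdiagE a0 mul0rn mxE.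
  by rewrite mulmx0 mul0mx.
move/eqP: H0; rewrite scaler_eq0 subr_eq0 => /orP[|/eqP <- //].
by rewrite eq_complex /= oner_eq0 andbF.
Qed.

Lemma psd_conj m n (A : 'M[C]_n) (B : 'M[C]_(m, n)) :
  psdmx A -> psdmx (B *m A *m B^h).
Proof.
move/psdmxP => pA; apply/psdmxP => v.
by have := pA (v *m B); rewrite hadjM !mulmxA.
Qed.

Lemma psd_diag_ge0 n (A : 'M[C]_n) i : psdmx A -> 0 <= complex.Re (A i i).
Proof.
move/psdmxP/(_ (delta_mx 0 i)) => h; apply: Re_ge0.
rewrite -rowE in h; rewrite /hadj trmx_delta map_delta_mx -colE !mxE in h.
by [].
Qed.

Lemma psdD n (A B : 'M[C]_n) : psdmx A -> psdmx B -> psdmx (A + B).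
Proof.
move=> /psdmxP pA /psdmxP pB; apply/psdmxP => v.
by rewrite mulmxDr mulmxDl mxE addr_ge0.
Qed.

Lemma psdZ n (A : 'M[C]_n) r : 0 <= r -> psdmx A -> psdmx (r%:C *: A).
Proof.
move=> r0 /psdmxP pA; apply/psdmxP => v.
by rewrite -scalemxAr -scalemxAl mxE mulr_ge0 // ler0c.
Qed.

Lemma psd_sum (I : finType) (P : pred I) n (F : I -> 'M[C]_n) :
  (forall i, psdmx (F i)) -> psdmx (\sum_(i | P i) F i).
Proof.
move=> pF; apply: (big_ind (@psdmx R n)) => //; last exact: psdD.
by apply/psdmxP => v; rewrite mulmx0 mul0mx mxE.
Qed.

Lemma eigdec_ge0 n (A U : 'M[C]_n) a i : psdmx A -> eigdec A U a -> 0 <= a i.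
Proof.
move=> pA eA.
by have := psd_diag_ge0 i (psd_conj U pA); rewrite (eigdec_diagE _ eA).
Qed.

End Adjoint.

(** * Trace inequalities: the sandwiched form, Klein's inequality and the entropy of one block *)

Lemma tr_quadratic_expand (K : comPzRingType) n (c : K) (W W' A D : 'M[K]_n) :
  \tr ((c *: W - D) *m A *m (c *: W' - D)) =
  c * (c * \tr (W *m A *m W')) - c * \tr (W *m A *m D)
  - c * \tr (D *m A *m W') + \tr (D *m A *m D).
Proof.
rewrite mulrA -!mxtraceZ -!linearB -linearD /=; congr (\tr _).
rewrite !mulmxBl !mulmxBr -!scalemxAl -!scalemxAr scalerA.
by rewrite opprB [X in _ + X]addrC addrA.
Qed.

Section Core.
Variable R : realType.
Local Notation C := R[i].
Local Notation "A ^h" := (hadj A).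

Lemma nsq_real (r : R) : nsq (r%:C : C) = r ^+ 2.
Proof. by rewrite /nsq /= oppr0 mulr0 subr0 expr2. Qed.

Lemma Re_tr n (A : 'M[C]_n) : complex.Re (\tr A) = \sum_i complex.Re (A i i).
Proof. exact: Re_sum. Qed.

Lemma tr_sum (I : Type) (r : seq I) (P : pred I) n (F : I -> 'M[C]_n) :
  \tr (\sum_(i <- r | P i) F i) = \sum_(i <- r | P i) \tr (F i).
Proof. exact: raddf_sum. Qed.

Lemma psd_tr_ge0 n (A : 'M[C]_n) : psdmx A -> 0 <= complex.Re (\tr A).
Proof. by move=> pA; rewrite Re_tr; apply: sumr_ge0 => i _; apply: psd_diag_ge0. Qed.

(** Kept bilinear, although the bounds concern [A = B], so that it expands over pairs of hash
    preimages. *)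
Definition sandwich n (x : 'I_n -> R) (A B : 'M[C]_n) : R :=
  complex.Re (\tr (A *m rdiag x *m B *m rdiag x)).

Lemma sandwich_herm n (x : 'I_n -> R) (A : 'M[C]_n) : A^h = A ->
  sandwich x A A = \sum_j \sum_k x j * x k * nsq (A j k).
Proof.
move=> hA; rewrite /sandwich Re_tr; apply: eq_bigr => j _.
rewrite mul_rdiagE mxE mulr_suml Re_sum; apply: eq_bigr => k _.
rewrite mul_rdiagE -{2}hA hadjE.
have -> : A j k * (x k)%:C * conjc (A j k) * (x j)%:C =
  (x j * x k)%:C * (A j k * conjc (A j k)) by rewrite rmorphM /=; ring.
by rewrite nsqE -rmorphM.
Qed.

Lemma sqr_herm_diag n (A : 'M[C]_n) j : A^h = A ->
  (A *m A) j j = (\sum_k nsq (A j k))%:C.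
Proof.
move=> hA; rewrite mxE realC_sum; apply: eq_bigr => k _.
by rewrite -{2}hA hadjE nsqE.
Qed.

(** Entrywise [x j * x k <= (x j ^+ 2 + x k ^+ 2) / 2]; the two halves have the same sum because
    [|A j k| = |A k j|]. *)
Lemma sandwich_le n (x : 'I_n -> R) (A : 'M[C]_n) : A^h = A ->
  sandwich x A A <= \sum_j x j ^+ 2 * complex.Re ((A *m A) j j).
Proof.
move=> hA; rewrite sandwich_herm //.
have nsqC j k : nsq (A j k) = nsq (A k j) by rewrite -{1}hA hadjE nsq_conj.
set S := \sum_j \sum_k x j ^+ 2 * nsq (A j k).
have -> : \sum_j x j ^+ 2 * complex.Re ((A *m A) j j) = S.
  by apply: eq_bigr => j _; rewrite sqr_herm_diag //= mulr_sumr.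
have S2 : S = \sum_j \sum_k x k ^+ 2 * nsq (A j k).
  rewrite /S exchange_big; apply: eq_bigr => j _; apply: eq_bigr => k _.
  by rewrite nsqC.
have -> : S = \sum_j \sum_k ((x j ^+ 2 + x k ^+ 2) / 2 * nsq (A j k)).
  have -> : S = (S + S) / 2 by lra.
  rewrite {2}S2 /S -big_split /= mulr_suml; apply: eq_bigr => j _.
  rewrite -big_split /= mulr_suml; apply: eq_bigr => k _; ring.
apply: ler_sum => j _; apply: ler_sum => k _.
apply: ler_wpM2r; first exact: nsq_ge0.
have := sqr_ge0 (x j - x k); rewrite !expr2; lra.
Qed.

Lemma tr_sandwich_cyclic n (U V D N : 'M[C]_n) :
  \tr (V *m D *m U *m N *m (V *m D *m U) *m N) =
  \tr (U *m N *m V *m D *m (U *m N *m V) *m D).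
Proof.
transitivity (\tr (V *m D *m (U *m N *m V *m D *m U *m N))).
  by rewrite !mulmxA.
by rewrite mxtrace_mulC !mulmxA.
Qed.

(** Cyclicity of the trace exchanges the roles: with [M = U diag(x) U^h] the form equals the sum of
    [a i * a k * |M i k|^2]. Dropping the nonnegative off-diagonal terms leaves the left side. *)
Lemma sandwich_eig_ge n (x : 'I_n -> R) (A U : 'M[C]_n) a :
  eigdec A U a -> (forall i, 0 <= a i) ->
  \sum_i a i ^+ 2 * (\sum_j nsq (U i j) * x j) ^+ 2 <= sandwich x A A.
Proof.
case=> uU AE a0; set M := U *m rdiag x *m U^h.
have hM : M^h = M by rewrite /M !hadjM hadjK hadj_rdiag mulmxA.
have -> : sandwich x A A = sandwich a M M.
  by rewrite /sandwich AE tr_sandwich_cyclic.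
rewrite sandwich_herm //; apply: ler_sum => i _.
rewrite [leRHS](bigD1 i) //= -[a i * a i]expr2.
have -> : M i i = (\sum_j nsq (U i j) * x j)%:C.
  rewrite mxE realC_sum; apply: eq_bigr => j _.
  by rewrite mul_rdiagE hadjE rmorphM /= -nsqE; ring.
rewrite nsq_real lerDl; apply: sumr_ge0 => k _.
by rewrite !mulr_ge0 // nsq_ge0.
Qed.

(** In the eigenbasis of [A] the trace is the sum of [a i] times the diagonal entries of [M B M^h],
    with [M = U diag(x)]. *)
Lemma sandwich_ge0 n (x : 'I_n -> R) (A B : 'M[C]_n) :
  psdmx A -> psdmx B -> 0 <= sandwich x A B.
Proof.
move=> pA pB; have eA := eigdec_spectral (psd_adj pA).
have a0 i := eigdec_ge0 i pA eA.
set U := spectralmx A in eA; set a := eigvals A in eA a0.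
case: eA => uU ->; clearbody a U.
rewrite /sandwich.
have -> : U^h *m rdiag a *m U *m rdiag x *m B *m rdiag x =
  U^h *m (rdiag a *m (U *m rdiag x *m B *m rdiag x)) by rewrite !mulmxA.
rewrite mxtrace_mulC -[_ *m U^h]mulmxA.
pose M := U *m rdiag x.
have -> : U *m rdiag x *m B *m rdiag x *m U^h = M *m B *m M^h.
  by rewrite /M hadjM hadj_rdiag !mulmxA.
rewrite Re_tr; apply: sumr_ge0 => i _; rewrite rdiag_mulE ReZ.
by apply: mulr_ge0 => //; apply: psd_diag_ge0; apply: psd_conj.
Qed.

Lemma sandwich_suml n (x : 'I_n -> R) (I : finType) (P : pred I)
  (F : I -> 'M[C]_n) B :
  sandwich x (\sum_(i | P i) F i) B = \sum_(i | P i) sandwich x (F i) B.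
Proof. by rewrite /sandwich !mulmx_suml tr_sum Re_sum. Qed.

Lemma sandwich_sumr n (x : 'I_n -> R) (I : finType) (P : pred I)
  (F : I -> 'M[C]_n) B :
  sandwich x B (\sum_(i | P i) F i) = \sum_(i | P i) sandwich x B (F i).
Proof. by rewrite /sandwich mulmx_sumr !mulmx_suml tr_sum Re_sum. Qed.

Lemma Re_diag_eigdec n (A U : 'M[C]_n) a j : eigdec A U a ->
  complex.Re (A j j) = \sum_i a i * nsq (U i j).
Proof. by move=> eA; rewrite (diag_eigdec j eA). Qed.

(** The squared moduli [|U i j|^2] are doubly stochastic, so the claim is the average with these
    weights of [mul_ln_le] at the pairs [(a i, y j)]. *)
Lemma klein n (A U : 'M[C]_n) a (y : 'I_n -> R) : eigdec A U a ->
  (forall i, 0 <= a i) -> (forall j, 0 < y j) ->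
  \sum_j complex.Re (A j j) * ln (y j) <=
    \sum_i a i * ln (a i) + \sum_j y j - \sum_i a i.
Proof.
move=> eA a0 y0; have [uU _] := eA.
have -> : \sum_j complex.Re (A j j) * ln (y j) =
    \sum_i \sum_j nsq (U i j) * (a i * ln (y j)).
  rewrite exchange_big; apply: eq_bigr => j _; rewrite (Re_diag_eigdec j eA).
  rewrite mulr_suml; apply: eq_bigr => i _; ring.
have -> : \sum_i a i * ln (a i) + \sum_j y j - \sum_i a i =
    \sum_i \sum_j nsq (U i j) * (a i * ln (a i) + (y j - a i)).
  transitivity (\sum_i \sum_j (nsq (U i j) * (a i * ln (a i) - a i)) +
                \sum_i \sum_j nsq (U i j) * y j).
    have -> : \sum_i \sum_j nsq (U i j) * y j = \sum_j y j.
      rewrite exchange_big; apply: eq_bigr => j _.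
      by rewrite -mulr_suml unitary_col_nsq // mul1r.
    have -> : \sum_i \sum_j nsq (U i j) * (a i * ln (a i) - a i) =
        \sum_i (a i * ln (a i) - a i).
      by apply: eq_bigr => i _; rewrite -mulr_suml unitary_row_nsq // mul1r.
    by rewrite sumrB; ring.
  rewrite -big_split; apply: eq_bigr => i _ /=; rewrite -big_split.
  by apply: eq_bigr => j _ /=; ring.
apply: ler_sum => i _; apply: ler_sum => j _; apply: ler_wpM2l.
  exact: nsq_ge0.
exact: mul_ln_le.
Qed.

(** Sums [scaled_jensen] over the eigenvalues, with weights [|U i j|^2]; [sandwich_eig_ge] gathers
    the squared means of [y^(-1/2)] into the sandwiched form. *)
Lemma block_entropy_le n (A U : 'M[C]_n) a (J : pred 'I_n) (y : 'I_n -> R) yQ t :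
  eigdec A U a -> (forall i, 0 <= a i <= 1) -> 0 < t ->
  (forall j, 0 < y j) -> (forall j, ~~ J j -> y j = yQ) ->
  \sum_i a i * ln (a i) - \sum_j complex.Re (A j j) * ln (y j) <=
    t * sandwich (fun j => if J j then (Num.sqrt (y j))^-1 else 0) A A
    - (\sum_(j | J j) complex.Re (A j j)) * (1 + ln t)
    + (\sum_(j | ~~ J j) complex.Re (A j j)) * (1 - ln yQ).
Proof.
move=> eA a01 t0 y0 yq; have [uU _] := eA.
set x := fun j => if J j then _ else 0.
have := sandwich_eig_ge x eA (fun i => proj1 (andP (a01 i))).
move=> /(ler_wpM2l (ltW t0)) hs.
have eD (P : pred 'I_n) : \sum_(j | P j) complex.Re (A j j) =
    \sum_i a i * \sum_(j | P j) nsq (U i j).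
  under eq_bigr do rewrite (Re_diag_eigdec _ eA).
  by rewrite exchange_big; apply: eq_bigr => i _; rewrite mulr_sumr.
have eL : \sum_j complex.Re (A j j) * ln (y j) =
    \sum_i a i * \sum_j nsq (U i j) * ln (y j).
  under eq_bigr do rewrite (Re_diag_eigdec _ eA) mulr_suml.
  rewrite exchange_big; apply: eq_bigr => i _; rewrite mulr_sumr.
  by apply: eq_bigr => j _; rewrite mulrA.
rewrite !eD eL -sumrB.
apply: (@le_trans _ _ (t * (\sum_i a i ^+ 2 * (\sum_j nsq (U i j) * x j) ^+ 2) -
  (\sum_i a i * \sum_(j | J j) nsq (U i j)) * (1 + ln t) +
  (\sum_i a i * \sum_(j | ~~ J j) nsq (U i j)) * (1 - ln yQ))); last by lra.
rewrite mulr_sumr !mulr_suml -sumrB -big_split /=.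
apply: ler_sum => i _.
have w1 := unitary_row_nsq i uU.
have := @scaled_jensen R _ J (fun j => nsq (U i j)) y (a i) t yQ
  (fun j => nsq_ge0 _) w1 (a01 i) t0 y0 yq.
have -> : \sum_j nsq (U i j) * x j =
    \sum_(j | J j) nsq (U i j) / Num.sqrt (y j).
  by rewrite [RHS]big_mkcond; apply: eq_bigr => j _; rewrite /x; case: ifP; rewrite ?mulr0.
have -> : 1 - \sum_(j | J j) nsq (U i j) = \sum_(j | ~~ J j) nsq (U i j).
  by rewrite -w1 (bigID J) /= addrAC subrr add0r.
by [].
Qed.

(* The rows [u_j = e_j A / sqrt (z j)], [z j != 0], are orthonormal; the claim follows
   from [0 <= \sum_J (b u_j - e_j) A (b u_j - e_j)^h], [b] being the sum on the left. *)
Lemma sum_sqrt_sqr_le n (A : 'M[C]_n) (J : pred 'I_n) (z : 'I_n -> R) :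
  psdmx A -> \tr A = 1 -> (forall j, 0 <= z j) ->
  (forall j k, J j -> J k -> (A *m A) j k = (z j *+ (j == k))%:C) ->
  (\sum_(j | J j) Num.sqrt (z j)) ^+ 2 <= \sum_(j | J j) complex.Re (A j j).
Proof.
move=> pA tA z0 hz; have hA := psd_adj pA.
set b := \sum_(j | J j) _.
(* Where [z j = 0] the inverse is [0] by default, so that row of [W] vanishes and [W W^h] is only a
   diagonal projection [E]. *)
pose s j := if J j then (Num.sqrt (z j))^-1 else 0.
pose o (j : 'I_n) : R := (J j)%:R.
pose W := rdiag s *m A.
pose E := rdiag (fun j => (J j && (z j != 0))%:R : R).
have WW : W *m W^h = E.
  rewrite /W hadjM hadj_rdiag hA; apply/matrixP => j k.
  rewrite -mulmxA rdiag_mulE mulmxA mul_rdiagE rdiagE /s.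
  case Jj : (J j) => /=; last by rewrite mul0r mul0rn.
  case Jk : (J k); last first.
    have -> : (j == k) = false by apply/negP => /eqP jk; rewrite -jk Jj in Jk.
    by rewrite !mulr0 mulr0n.
  rewrite hz // -!rmorphM /=; congr (_%:C).
  case: eqP => [<-|_]; last by rewrite !mulr0n mul0r mulr0.
  rewrite !mulr1n; have [->|zn] := eqVneq (z j) 0; first by rewrite mul0r mulr0.
  have sn : Num.sqrt (z j) != 0 by rewrite sqrtr_eq0 -ltNge lt_neqAle eq_sym zn z0.
  by rewrite -{2}(sqr_sqrtr (z0 j)) /=; field.
have EW : E *m W = W.
  rewrite /W mulmxA rdiagM; congr (_ *m _); congr diag_mx; apply/rowP => j.
  rewrite !mxE /s; case: (J j); last by rewrite mulr0.
  by have [->|zn] /= := eqVneq (z j) 0; rewrite ?mul1r // sqrtr0 invr0 mulr0.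
pose T := W^h *m W.
have TT : T *m T = T by rewrite /T -mulmxA (mulmxA W) WW EW.
have hT : T^h = T by rewrite /T hadjM hadjK.
(* The trace is [Tr (T A)] with [T] an orthogonal projection, hence at most [Tr A = 1]. *)
have trW : complex.Re (\tr (W *m A *m W^h)) <= 1.
  have := psd_tr_ge0 (psd_conj (1%:M - T) pA).
  have T1 : (1%:M - T) *m (1%:M - T) = 1%:M - T.
    by rewrite mulmxBl mul1mx mulmxBr mulmx1 TT subrr subr0.
  have TA : \tr (T *m A) = \tr (W *m A *m W^h) by rewrite /T -mulmxA mxtrace_mulC.
  rewrite hadjB hadj_scalar1 hT mxtrace_mulC mulmxA T1 mulmxBl mul1mx linearB /= TA.
  by rewrite ReD ReN tA /=; lra.
have := psd_tr_ge0 (psd_conj (b%:C *: W - rdiag o) pA).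
rewrite hadjB hadjZ hadj_rdiag.
rewrite tr_quadratic_expand.
have oo j : o j * o j = o j by rewrite /o; case: (J j); rewrite ?mulr0 ?mulr1.
have t1 : complex.Re (\tr (W *m A *m rdiag o)) = b.
  rewrite Re_tr /b [RHS]big_mkcond; apply: eq_bigr => j _; rewrite mul_rdiagE mulrC.
  rewrite ReZ /W -mulmxA rdiag_mulE ReZ /o /s.
  case Jj : (J j); last by rewrite mul0r.
  rewrite mul1r hz // eqxx mulr1n /=.
  have [->|zn] := eqVneq (z j) 0; first by rewrite mulr0 sqrtr0.
  have sn : Num.sqrt (z j) != 0 by rewrite sqrtr_eq0 -ltNge lt_neqAle eq_sym zn z0.
  by rewrite -{2}(sqr_sqrtr (z0 j)); field.
have t2 : complex.Re (\tr (rdiag o *m A *m W^h)) = b.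
  rewrite -t1; have -> : rdiag o *m A *m W^h = (W *m A *m rdiag o)^h.
    by rewrite [RHS]hadjM [(W *m A)^h]hadjM hA hadj_rdiag mulmxA.
  by rewrite !Re_tr; apply: eq_bigr => j _; rewrite hadjE; case: (_ j j).
have t3 : complex.Re (\tr (rdiag o *m A *m rdiag o)) = \sum_(j | J j) complex.Re (A j j).
  rewrite Re_tr [RHS]big_mkcond; apply: eq_bigr => j _.
  rewrite mul_rdiagE rdiag_mulE mulrC ReZ ReZ mulrA oo /o.
  by case: (J j); rewrite ?mul1r ?mul0r.
move: (\tr (W *m A *m W^h)) (\tr (W *m A *m rdiag o)) (\tr (rdiag o *m A *m W^h))
  (\tr (rdiag o *m A *m rdiag o)) trW t1 t2 t3 => T1 T2 T3 T4.
move: (\sum_(j | J j) _) => q T1le T2E T3E T4E; clearbody b.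
rewrite !ReD !ReN !ReZ T2E T3E T4E.
have := ler_wpM2l (sqr_ge0 b) T1le; rewrite expr2; lra.
Qed.

End Core.

(** * Two-universal hashing and the entropy bound in an adapted basis *)

Section Hash.
Variable R : realType.
Local Notation C := R[i].
Variables (X S G : finType) (n : nat) (gf : G -> {ffun X -> S}).

Lemma sum_fibers (V : nmodType) (g : G) (F : X -> V) :
  \sum_s \sum_(x | gf g x == s) F x = \sum_x F x.
Proof.
by rewrite [RHS](partition_big (gf g) xpredT).
Qed.

(** Exchanging sums counts the [g] that identify [x] and [x']. Equal pairs always collide and give
    the first term; distinct pairs collide with probability at most [1 / |S|]. Nonnegativity of [F]
    allows the diagonal to be added to the second term. *)
Lemma two_universal_sum_le (F : X -> X -> R) :
  (0 < #|G|)%N -> two_universal R gf -> (forall x x', 0 <= F x x') ->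
  #|G|%:R^-1 * (\sum_g \sum_s \sum_(x | gf g x == s) \sum_(x' | gf g x' == s) F x x')
  <= \sum_x F x x + #|S|%:R^-1 * (\sum_x \sum_x' F x x').
Proof.
move=> G0 tu F0.
have -> : \sum_g \sum_s \sum_(x | gf g x == s) \sum_(x' | gf g x' == s) F x x' =
    \sum_x \sum_x' #|[set g | gf g x == gf g x']|%:R * F x x'.
  transitivity (\sum_g \sum_x \sum_x' (gf g x == gf g x')%:R * F x x').
    apply: eq_bigr => g _; rewrite -[RHS](sum_fibers g); apply: eq_bigr => s _.
    apply: eq_bigr => x /eqP <-; rewrite big_mkcond; apply: eq_bigr => x' _.
    by rewrite eq_sym; case: eqP; rewrite ?mul1r ?mul0r.
  rewrite exchange_big; apply: eq_bigr => x _; rewrite exchange_big.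
  apply: eq_bigr => x' _; rewrite -mulr_suml; congr (_ * _).
  by rewrite -natr_sum -sum1dep_card [in RHS]big_mkcond; congr _%:R; apply: eq_bigr => g _; case: eqP.
rewrite !mulr_sumr -big_split /=; apply: ler_sum => x _.
rewrite !mulr_sumr (bigD1 x) //= [in leRHS](bigD1 x) //= addrA.
have G0' : (#|G|%:R : R) != 0 by rewrite pnatr_eq0 -lt0n.
apply: lerD.
  have -> : [set g | gf g x == gf g x] = [set: G] by apply/setP => g; rewrite !inE eqxx.
  by rewrite cardsT mulrA mulVf // mul1r lerDl mulr_ge0 // invr_ge0 ler0n.
apply: ler_sum => x' xx'; rewrite mulrA; apply: ler_wpM2r => //.
by rewrite mulrC -[leRHS]div1r; apply: tu; rewrite eq_sym.
Qed.

Variable tau : X -> 'M[C]_n.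
Hypothesis tau_psd : forall x, psdmx (tau x).

(** The unnormalised conditional state: keeping the probability inside avoids dividing by one that
    may vanish. *)
Definition hash_sum g s := \sum_(x | gf g x == s) tau x.

Lemma hash_sandwich_le (x : 'I_n -> R) : (0 < #|G|)%N -> two_universal R gf ->
  #|G|%:R^-1 * (\sum_g \sum_s sandwich x (hash_sum g s) (hash_sum g s)) <=
  \sum_i sandwich x (tau i) (tau i)
  + #|S|%:R^-1 * sandwich x (\sum_i tau i) (\sum_i tau i).
Proof.
move=> G0 tu; have -> : sandwich x (\sum_i tau i) (\sum_i tau i) =
    \sum_i \sum_j sandwich x (tau i) (tau j).
  by rewrite sandwich_suml; apply: eq_bigr => i _; rewrite sandwich_sumr.
apply: le_trans (two_universal_sum_le G0 tu _); last first.
  by move=> i j; apply: sandwich_ge0.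
rewrite le_eqVlt; apply/orP; left; apply/eqP; congr (_ * _).
apply: eq_bigr => g _; apply: eq_bigr => s _.
by rewrite sandwich_suml; apply: eq_bigr => i _; rewrite sandwich_sumr.
Qed.

Lemma sqrt_damped_le (z k : R) : 0 <= z -> 0 < k ->
  (Num.sqrt z + k)^-1 * z <= Num.sqrt z.
Proof.
move=> z0 k0; have s0 := sqrtr_ge0 z.
have p : 0 < Num.sqrt z + k by lra.
rewrite mulrC ler_pdivrMr // -{1}(sqr_sqrtr z0) expr2 mulrDr lerDl.
by rewrite mulr_ge0 // ltW.
Qed.

(** Adds [klein] for the total operator to the average over [g] of [block_entropy_le] with
    [t = |S|]. One copy of [b] comes from the sum of [y] over [J], the other from the [1 / |S|] term
    of two-universality; [|S| c b] comes from the equal pairs. The shift costs [k] at most [n] times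
    on [J] and once off it. *)
Lemma entropy_defect_le (Us : G -> S -> 'M[C]_n) (a : G -> S -> 'I_n -> R)
    (U : 'M[C]_n) (r : 'I_n -> R) (J : pred 'I_n) (z : 'I_n -> R) (c k : R) d :
  (0 < #|G|)%N -> (0 < #|S|)%N -> two_universal R gf ->
  (forall g s, eigdec (hash_sum g s) (Us g s) (a g s)) ->
  (forall g s i, 0 <= a g s i <= 1) ->
  eigdec (\sum_x tau x) U r -> (forall i, 0 <= r i) -> \sum_i r i = 1 ->
  (forall j, 0 <= z j) ->
  (forall j, J j -> complex.Re (((\sum_x tau x) *m (\sum_x tau x)) j j) = z j) ->
  (forall j, J j -> complex.Re ((\sum_x tau x *m tau x) j j) <= c * z j) ->
  0 <= c -> (0 < d)%N -> (#|[pred j | ~~ J j]| <= d)%N -> 0 < k ->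
  let e := \sum_(j | ~~ J j) complex.Re ((\sum_x tau x) j j) in
  let b := \sum_(j | J j) Num.sqrt (z j) in
  ln #|S|%:R + #|G|%:R^-1 * (\sum_g \sum_s \sum_i a g s i * ln (a g s i))
    - \sum_i r i * ln (r i) <=
  (e * ln (d%:R * #|S|%:R) - e * ln e + 2 * (b - (1 - e)) + e
    + #|S|%:R * c * b + k * n.+1%:R).
Proof.
move=> G0 S0 tu ea a01 eB r0 r1 z0 hz hc c0 d0 hd k0 /=.
set e := \sum_(j | ~~ J j) _; set b := \sum_(j | J j) _.
set B := \sum_x tau x in eB hz e *.
set t : R := #|S|%:R; set gi : R := #|G|%:R^-1.
have t0 : 0 < t by rewrite ltr0n.
have gi0 : 0 <= gi by rewrite invr_ge0 ler0n.
have dR : 0 < d%:R :> R by rewrite ltr0n.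
have pB : psdmx B by apply: psd_sum.
have e0 : 0 <= e by apply: sumr_ge0 => j _; apply: psd_diag_ge0.
have trB : \sum_j complex.Re (B j j) = 1 by rewrite -Re_tr (tr_eigdec eB) /= r1.
have eJ : \sum_(j | J j) complex.Re (B j j) = 1 - e.
  by move: trB; rewrite (bigID J) /= -/e; lra.
(* The mass [e + k] is spread over [d] places, at least as many as there are indices off [J], so
   these entries of [y] sum to at most [e + k]. *)
pose yQ := (e + k) / d%:R.
pose y j := if J j then Num.sqrt (z j) + k else yQ.
have yQ0 : 0 < yQ by rewrite divr_gt0 //; lra.
have y0 j : 0 < y j.
  by rewrite /y; case: ifP => // _; have := sqrtr_ge0 (z j); lra.
have yq j : ~~ J j -> y j = yQ by rewrite /y => /negbTE ->.
have KL := klein eB r0 y0; rewrite r1 in KL.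
have fibB g (j : 'I_n) : \sum_s complex.Re (hash_sum g s j j) = complex.Re (B j j).
  by rewrite -Re_sum /B -(sum_fibers g tau) summxE.
have BL := fun g s => block_entropy_le (ea g s) (a01 g s) t0 y0 yq.
set x := fun j => if J j then _ else 0 in BL.
set L := \sum_j complex.Re (B j j) * ln (y j) in KL.
have BG g : \sum_s \sum_i a g s i * ln (a g s i) - L <=
    t * (\sum_s sandwich x (hash_sum g s) (hash_sum g s))
    - (1 - e) * (1 + ln t) + e * (1 - ln yQ).
  have -> : L = \sum_s \sum_j complex.Re (hash_sum g s j j) * ln (y j).
    rewrite exchange_big; apply: eq_bigr => j _.
    by rewrite -mulr_suml fibB.
  have -> : 1 - e = \sum_s \sum_(j | J j) complex.Re (hash_sum g s j j).
    by rewrite -eJ exchange_big; apply: eq_bigr => j _; rewrite fibB.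
  have -> : e = \sum_s \sum_(j | ~~ J j) complex.Re (hash_sum g s j j).
    by rewrite exchange_big; apply: eq_bigr => j _; rewrite fibB.
  rewrite -sumrB mulr_sumr !mulr_suml -sumrB -big_split /=.
  by apply: ler_sum => s _; apply: BL.
have {BL}BA : gi * (\sum_g \sum_s \sum_i a g s i * ln (a g s i)) - L <=
    t * (gi * \sum_g \sum_s sandwich x (hash_sum g s) (hash_sum g s))
    - (1 - e) * (1 + ln t) + e * (1 - ln yQ).
  have giG (q : R) : gi * \sum_(g : G) q = q.
    rewrite sumr_const -mulr_natl mulrA mulVf ?mul1r //.
    by rewrite pnatr_eq0 -lt0n.
  have := ler_wpM2l gi0 (ler_sum (index_enum G) (P := xpredT) (fun g _ => BG g)).
  rewrite sumrB big_split /= sumrB -mulr_sumr !mulrDr !mulrN !giG.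
  by rewrite mulrCA.
have SL := ler_wpM2l (ltW t0) (hash_sandwich_le x G0 tu).
have x2 j : x j ^+ 2 = if J j then (y j)^-1 else 0.
  rewrite /x; case: ifP => // _; last by rewrite expr0n.
  by rewrite exprVn sqr_sqrtr // ltW.
(* By [sandwich_le] the form is at most the sum over [J] of [z j / (sqrt (z j) + k)]; the collision
   terms in [ST] get the same bound times [c]. *)
have SB : sandwich x B B <= b.
  apply: le_trans (sandwich_le x (psd_adj pB)) _.
  rewrite /b [leRHS]big_mkcond; apply: ler_sum => j _; rewrite x2.
  case: ifP => Jj; last by rewrite mul0r.
  by rewrite hz // /y Jj; apply: sqrt_damped_le.
have ST : \sum_i sandwich x (tau i) (tau i) <= c * b.
  apply: (@le_trans _ _ (\sum_j x j ^+ 2 * complex.Re ((\sum_i tau i *m tau i) j j))).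
    have -> : \sum_j x j ^+ 2 * complex.Re ((\sum_i tau i *m tau i) j j) =
        \sum_i \sum_j x j ^+ 2 * complex.Re ((tau i *m tau i) j j).
      rewrite exchange_big; apply: eq_bigr => j _.
      by rewrite summxE Re_sum mulr_sumr.
    by apply: ler_sum => i _; apply: sandwich_le; apply: psd_adj.
  rewrite /b mulr_sumr [leRHS]big_mkcond; apply: ler_sum => j _; rewrite x2.
  case: ifP => Jj; last by rewrite mul0r.
  apply: (@le_trans _ _ ((y j)^-1 * (c * z j))).
    by apply: ler_wpM2l; [rewrite invr_ge0 ltW | apply: hc].
  rewrite mulrCA; apply: ler_wpM2l => //.
  by rewrite /y Jj; apply: sqrt_damped_le.
have Sy : \sum_j y j <= b + k * n%:R + (e + k).
  rewrite (bigID J) /=; apply: lerD.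
    have -> : \sum_(j | J j) y j = b + \sum_(j | J j) k.
      by rewrite /b -big_split; apply: eq_bigr => j Jj; rewrite /y Jj.
    rewrite lerD2l sumr_const -[leLHS]mulr_natr; apply: ler_wpM2l; first exact: ltW.
    by rewrite ler_nat; apply: leq_trans (max_card _) _; rewrite card_ord.
  rewrite (eq_bigr (fun=> yQ)) // sumr_const -mulr_natl.
  apply: (@le_trans _ _ (d%:R * yQ)).
    by apply: ler_wpM2r; [exact: ltW | rewrite ler_nat].
  by rewrite /yQ mulrC divfK // gt_eqF.
have LQ : e * ln e - e * ln d%:R <= e * ln yQ.
  rewrite /yQ ln_div ?posrE //; last by lra.
  rewrite mulrBr lerD2r.
  have [->|en] := eqVneq e 0; first by rewrite !mul0r.
  apply: ler_wpM2l => //; apply: ln_le_pos; last by lra.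
  by rewrite lt_neqAle eq_sym en.
have tS : t * (\sum_i sandwich x (tau i) (tau i)) <= t * (c * b).
  by apply: ler_wpM2l => //; apply: ltW.
have tB : t * (t^-1 * sandwich x B B) <= b.
  by rewrite mulrA mulfV ?mul1r // gt_eqF.
rewrite mulrDr in SL.
have nS : (n.+1%:R : R) = n%:R + 1 by rewrite -natr1.
rewrite nS lnM ?posrE //.
move: (gi * _) (sandwich x B B) (\sum_i sandwich x (tau i) (tau i)) (gi * _) SL tS tB BA KL => *.
lra.
Qed.

End Hash.

(** * Block-diagonal operators and the relative entropy of the hashed state *)

Section Block.
Variable R : realType.
Local Notation C := R[i].
Local Notation "A ^h" := (hadj A).

Lemma sum_mxtens (V : nmodType) m n (F : 'I_(m * n) -> V) :
  \sum_k F k = \sum_i \sum_j F (mxtens_index (i, j)).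
Proof.
rewrite pair_big /= (reindex (@mxtens_index m n)) /=.
  by apply: eq_bigr => -[i j].
by exists (@mxtens_unindex m n) => i; rewrite (mxtens_indexK, mxtens_unindexK).
Qed.

(** Written with [ket_proj] and tensor products so that the classical-quantum states of the theorem
    are instances after moving scalars. *)
Definition blockdiag (T : finType) n (A : T -> 'M[C]_n) : 'M[C]_(#|T| * n) :=
  \sum_t ket_proj t *t A t.

Lemma blockdiagE (T : finType) n (A : T -> 'M[C]_n) i j k l :
  blockdiag A (mxtens_index (i, j)) (mxtens_index (k, l)) =
  if i == k then A (enum_val i) j l else 0.
Proof.
rewrite summxE (bigD1 (enum_val i)) //= tensmxE mxE enum_valK eqxx /=.
rewrite big1 ?addr0 => [|t ti].
  by rewrite eq_sym; case: eqP; rewrite ?mul1r ?mul0r.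
rewrite tensmxE mxE; case: eqP => [ei|]; last by rewrite mul0r.
by rewrite ei enum_rankK eqxx in ti.
Qed.

Lemma eq_mx_tens m n (A B : 'M[C]_(m * n)) :
  (forall i j k l, A (mxtens_index (i, j)) (mxtens_index (k, l)) =
                   B (mxtens_index (i, j)) (mxtens_index (k, l))) -> A = B.
Proof.
move=> AB; apply/matrixP => x y.
by case: (mxtens_indexP x) => i j; case: (mxtens_indexP y) => k l.
Qed.

Lemma sum_enum_val (T : finType) (V : nmodType) (F : T -> V) :
  \sum_(i < #|T|) F (enum_val i) = \sum_t F t.
Proof.
rewrite (reindex_onto enum_rank enum_val) /=; last by move=> i _; rewrite enum_valK.
by apply: eq_big => t; rewrite ?enum_rankK ?eqxx.
Qed.

Lemma blockdiagM (T : finType) n (A B : T -> 'M[C]_n) :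
  blockdiag A *m blockdiag B = blockdiag (fun t => A t *m B t).
Proof.
apply: eq_mx_tens => i j k l; rewrite mxE sum_mxtens blockdiagE.
rewrite (bigD1 i) //= [X in _ + X]big1 ?addr0 => [|i' ii'].
  case: eqP => ik; last by apply: big1 => m _; rewrite !blockdiagE (introF eqP ik) mulr0.
  by rewrite mxE; apply: eq_bigr => m _; rewrite !blockdiagE eqxx ik eqxx.
by apply: big1 => m _; rewrite !blockdiagE eq_sym (negbTE ii') mul0r.
Qed.

Lemma blockdiagB (T : finType) n (A B : T -> 'M[C]_n) :
  blockdiag A - blockdiag B = blockdiag (fun t => A t - B t).
Proof.
apply: eq_mx_tens => i j k l; rewrite !mxE !blockdiagE.
by case: eqP => _; rewrite ?mxE ?subr0.
Qed.

Lemma eq_blockdiag (T : finType) n (A B : T -> 'M[C]_n) :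
  A =1 B -> blockdiag A = blockdiag B.
Proof. by move=> AB; apply: eq_bigr => t _; rewrite AB. Qed.

Lemma hadj_blockdiag (T : finType) n (A : T -> 'M[C]_n) :
  (blockdiag A)^h = blockdiag (fun t => (A t)^h).
Proof.
apply: eq_mx_tens => i j k l; rewrite hadjE !blockdiagE eq_sym.
by case: eqP => [->|_]; rewrite ?hadjE // conjc0.
Qed.

Lemma blockdiag1 (T : finType) n : blockdiag (fun _ : T => 1%:M : 'M[C]_n) = 1%:M.
Proof.
apply: eq_mx_tens => i j k l; rewrite blockdiagE !mxE.
rewrite (inj_eq (can_inj (@mxtens_indexK #|T| n))) xpair_eqE.
by case: (i == k).
Qed.

Lemma tr_blockdiag (T : finType) n (A : T -> 'M[C]_n) :
  \tr (blockdiag A) = \sum_t \tr (A t).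
Proof.
rewrite /mxtrace sum_mxtens -[RHS]sum_enum_val; apply: eq_bigr => i _.
by apply: eq_bigr => j _; rewrite blockdiagE eqxx.
Qed.

Lemma ptrace1_blockdiag (T : finType) n (A : T -> 'M[C]_n) :
  ptrace1 (blockdiag A) = \sum_t A t.
Proof.
apply/matrixP => j k; rewrite mxE summxE -[RHS]sum_enum_val.
by apply: eq_bigr => i _; rewrite blockdiagE eqxx.
Qed.

Lemma blockdiag_rdiag (T : finType) n (a : T -> 'I_n -> R) :
  blockdiag (fun t => rdiag (a t)) =
  rdiag (fun k => a (enum_val (mxtens_unindex k).1) (mxtens_unindex k).2).
Proof.
apply: eq_mx_tens => i j k l; rewrite blockdiagE !rdiagE mxtens_indexK /=.
rewrite (inj_eq (can_inj (@mxtens_indexK #|T| n))) xpair_eqE.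
by case: (i == k); rewrite ?mulr0n.
Qed.

Lemma eigdec_blockdiag (T : finType) n (A U : T -> 'M[C]_n) (a : T -> 'I_n -> R) :
  (forall t, eigdec (A t) (U t) (a t)) ->
  eigdec (blockdiag A) (blockdiag U)
    (fun k => a (enum_val (mxtens_unindex k).1) (mxtens_unindex k).2).
Proof.
move=> eA; split.
  rewrite /unitary hadj_blockdiag blockdiagM -blockdiag1; apply: eq_blockdiag => t.
  by case: (eA t).
rewrite hadj_blockdiag -blockdiag_rdiag !blockdiagM; apply: eq_blockdiag => t.
by case: (eA t).
Qed.

Lemma mxfun_blockdiag (T : finType) n (A : T -> 'M[C]_n) (f : R -> R) :
  (forall t, (A t)^h = A t) ->
  mxfun f (blockdiag A) = blockdiag (fun t => mxfun f (A t)).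
Proof.
move=> hA; have eA t := eigdec_spectral (hA t).
rewrite (mxfun_eigdec f (eigdec_blockdiag eA)).
rewrite hadj_blockdiag.
rewrite -(blockdiag_rdiag (fun t => f \o eigvals (A t))) !blockdiagM.
by apply: eq_blockdiag => t; rewrite (mxfun_eigdec f (eA t)).
Qed.

Lemma relent_blockdiag (T : finType) n (A B : T -> 'M[C]_n) :
  (forall t, (A t)^h = A t) -> (forall t, (B t)^h = B t) ->
  relent (blockdiag A) (blockdiag B) = \sum_t relent (A t) (B t).
Proof.
move=> hA hB; rewrite /relent /mlog2 !mxfun_blockdiag // blockdiagB blockdiagM.
by rewrite tr_blockdiag Re_sum.
Qed.

(** The factor [x] hides the default values of [ln] and [log2] at [0], so zero eigenvalues obey
    [0 log 0 = 0] in what follows. *)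
Lemma mul_log2 (c x : R) : 0 < c -> 0 <= x ->
  x * log2 (c * x) = (x * ln c + x * ln x) / ln 2.
Proof.
move=> c0; rewrite le_eqVlt => /orP[/eqP <-|x0]; first by rewrite !mul0r addr0 mul0r.
by rewrite /log2 mulr_gt0 // mulrA lnM ?posrE // mulrDr.
Qed.

(** Both arguments have blocks indexed by [(s, g)]. For each [g] the cross terms sum to [Tr (B L)],
    since the [w s g] sum to [B] over [s]. The logarithms of the factor [1 / |G|] cancel and that of
    [1 / |S|] leaves [ln |S|]. *)
Lemma relent_hash (S G : finType) n (w : S -> G -> 'M[C]_n) (B : 'M[C]_n) :
  (0 < #|S|)%N -> (0 < #|G|)%N ->
  (forall s g, psdmx (w s g)) -> psdmx B -> \tr B = 1 ->
  (forall g, \sum_s w s g = B) ->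
  relent (blockdiag (fun s => blockdiag (fun g => (#|G|%:R^-1)%:C *: w s g)))
         (blockdiag (fun s : S => blockdiag (fun g : G => (#|S|%:R^-1 * #|G|%:R^-1)%:C *: B)))
  = (ln #|S|%:R
     + #|G|%:R^-1 * (\sum_g \sum_s \sum_i eigvals (w s g) i * ln (eigvals (w s g) i))
     - \sum_i eigvals B i * ln (eigvals B i)) / ln 2.
Proof.
move=> S0 G0 pw pB tB wB.
set gi : R := #|G|%:R^-1; set t : R := #|S|%:R.
have t0 : 0 < t by rewrite ltr0n.
have gi0 : 0 < gi by rewrite invr_gt0 ltr0n.
have tg0 : 0 < t^-1 * gi by rewrite mulr_gt0 // invr_gt0.
have hw s g := psd_adj (pw s g).
have hB := psd_adj pB.
have ew s g := eigdec_spectral (hw s g); have eB := eigdec_spectral hB.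
have w0 s g i := eigdec_ge0 i (pw s g) (ew s g).
have B0 i := eigdec_ge0 i pB eB.
have h1 s g : (gi%:C *: w s g)^h = gi%:C *: w s g by rewrite hadjZ hw.
have h2 : ((t^-1 * gi)%:C *: B)^h = (t^-1 * gi)%:C *: B by rewrite hadjZ hB.
rewrite relent_blockdiag; last 2 first.
- by move=> s; rewrite hadj_blockdiag; apply: eq_blockdiag => g; apply: h1.
- by move=> s; rewrite hadj_blockdiag; apply: eq_blockdiag => g; apply: h2.
have -> : \sum_s relent (blockdiag (fun g => gi%:C *: w s g))
    (blockdiag (fun _ : G => (t^-1 * gi)%:C *: B)) =
  \sum_g \sum_s relent (gi%:C *: w s g) ((t^-1 * gi)%:C *: B).
  rewrite exchange_big; apply: eq_bigr => s _.
  by rewrite relent_blockdiag // => g; apply: h1.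
set L := mlog2 ((t^-1 * gi)%:C *: B).
have trBL : complex.Re (\tr (B *m L)) =
    (ln (t^-1 * gi) + \sum_i eigvals B i * ln (eigvals B i)) / ln 2.
  rewrite /L /mlog2 (mxfun_eigdec _ (eigdecZ _ eB)) (tr_mul_eigdec _ eB) /=.
  under eq_bigr do rewrite mul_log2 //.
  rewrite -mulr_suml big_split /= -mulr_suml.
  have -> : \sum_i eigvals B i = 1.
    by apply: (@complexI R); rewrite -(tr_eigdec eB) tB.
  by rewrite mul1r.
have rel s g : relent (gi%:C *: w s g) ((t^-1 * gi)%:C *: B) =
    gi * ((ln gi * complex.Re (\tr (w s g)) +
           \sum_i eigvals (w s g) i * ln (eigvals (w s g) i)) / ln 2)
    - gi * complex.Re (\tr (w s g *m L)).
  rewrite /relent -/L -scalemxAl mxtraceZ ReZ mulmxBr linearB /= ReD ReN mulrBr.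
  congr (_ * _ - _).
  rewrite /mlog2 (mxfun_eigdec _ (eigdecZ _ (ew s g))) (tr_mul_eigdec _ (ew s g)) /=.
  under eq_bigr do rewrite mul_log2 //.
  by rewrite -mulr_suml big_split /= -mulr_suml (tr_eigdec (ew s g)) /= [_ * ln gi]mulrC.
under eq_bigr => g _ do under eq_bigr => s _ do rewrite rel.
have inner g : \sum_s (gi * ((ln gi * complex.Re (\tr (w s g)) +
           \sum_i eigvals (w s g) i * ln (eigvals (w s g) i)) / ln 2)
    - gi * complex.Re (\tr (w s g *m L))) =
   gi * ((ln gi + \sum_s \sum_i eigvals (w s g) i * ln (eigvals (w s g) i)) / ln 2)
   - gi * complex.Re (\tr (B *m L)).
  rewrite sumrB -!mulr_sumr -mulr_suml big_split /= -mulr_sumr.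
  rewrite -!Re_sum -!tr_sum -mulmx_suml wB tB /= mulr1.
  by [].
under eq_bigr => g _ do rewrite inner.
have sumG (q : R) : \sum_(g : G) q = #|G|%:R * q by rewrite sumr_const mulr_natl.
have Gg : #|G|%:R * gi = 1 by rewrite mulfV // pnatr_eq0 -lt0n.
have gG (q : R) : gi * (#|G|%:R * q) = q by rewrite mulrA [gi * _]mulrC Gg mul1r.
have gG' (q : R) : #|G|%:R * (gi * q) = q by rewrite mulrA Gg mul1r.
rewrite sumrB trBL -mulr_sumr -mulr_suml big_split /= !sumG gG'.
rewrite [gi * (_ / _)]mulrA mulrDr gG -mulrBl lnM ?posrE ?invr_gt0 ?ltr0n // lnV ?posrE //.
by congr (_ / _); ring.
Qed.

End Block.

(** * Supports, ranks and the basis adapted to the spectral projection *)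

Lemma coker_submx (F : fieldType) m n (A : 'M[F]_(m, n)) (B : 'M[F]_n) :
  (forall K : 'M[F]_n, B *m K = 0 -> A *m K = 0) -> (A <= B)%MS.
Proof. by move=> h; rewrite submxE h // mulmx_coker. Qed.

Lemma tr1_rank_gt0 (F : fieldType) n (A : 'M[F]_n) : \tr A = 1 -> (0 < \rank A)%N.
Proof.
move=> trA; rewrite lt0n mxrank_eq0; apply/eqP => A0.
by move/eqP: trA; rewrite A0 mxtrace0 eq_sym oner_eq0.
Qed.

Section Projection.
Variable R : realType.
Local Notation C := R[i].
Local Notation "A ^h" := (hadj A).

Lemma nsq_eq0 (z : C) : nsq z = 0 -> z = 0.
Proof.
move=> z0; have := nsqE z; rewrite z0 => /eqP; rewrite mulf_eq0 conjc_eq0 orbb.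
by move/eqP.
Qed.

(** In the eigenbasis of [A] each diagonal entry is a sum of terms [a k * |(U K) k j|^2 >= 0]; if it
    vanishes, then so does every [a k * (U K) k j]. *)
Lemma psd_kernel n m (A : 'M[C]_n) (K : 'M[C]_(n, m)) : psdmx A ->
  (forall j, complex.Re ((K^h *m A *m K) j j) = 0) -> A *m K = 0.
Proof.
move=> pA; have eA := eigdec_spectral (psd_adj pA).
have a0 i := eigdec_ge0 i pA eA.
set U := spectralmx A in eA; set a := eigvals A in eA a0.
case: eA => _ ->; clearbody U a => KAK.
suff -> : U^h *m rdiag a *m U *m K = U^h *m (rdiag a *m (U *m K)).
  suff -> : rdiag a *m (U *m K) = 0 by rewrite mulmx0.
  apply/matrixP => i j; rewrite rdiag_mulE [RHS]mxE.
  have := KAK j.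
  have -> : K^h *m (U^h *m rdiag a *m U) *m K = (U *m K)^h *m (rdiag a *m (U *m K)).
    by rewrite hadjM !mulmxA.
  rewrite mxE Re_sum.
  have -> : \sum_i complex.Re ((U *m K)^h j i * (rdiag a *m (U *m K)) i j) =
      \sum_i a i * nsq ((U *m K) i j).
    apply: eq_bigr => k _; rewrite hadjE rdiag_mulE mulrCA ReZ; congr (_ * _).
    by rewrite /nsq mulrC.
  move=> /psumr_eq0P h; have {h} := h (fun k _ => mulr_ge0 (a0 k) (nsq_ge0 _)) i isT.
  move/eqP; rewrite mulf_eq0 => /orP[/eqP -> | /eqP /nsq_eq0 ->].
    by rewrite mul0r.
  by rewrite mulr0.
by rewrite !mulmxA.
Qed.

(** A vector killed by the sum has zero total quadratic form; its nonnegative summands vanish, and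
    [psd_kernel] applies to each. *)
Lemma psd_sub_sum (X : finType) n (tau : X -> 'M[C]_n) x :
  (forall x, psdmx (tau x)) -> (tau x <= (\sum_x tau x)%R)%MS.
Proof.
move=> pt; apply: coker_submx => K.
set B := \sum_x tau x => BK; have {BK}K0 : B *m K = 0 := BK.
apply: psd_kernel => // j.
have ge0 y : 0 <= complex.Re ((K^h *m tau y *m K) j j).
  by have := psd_diag_ge0 j (psd_conj (K^h) (pt y)); rewrite hadjK.
have : \sum_y complex.Re ((K^h *m tau y *m K) j j) = 0.
  by rewrite -Re_sum -summxE -mulmx_suml -mulmx_sumr -/B -mulmxA K0 mulmx0 mxE.
by move/psumr_eq0P; apply.
Qed.

(** The coordinate rows selected by [J] are independent and fixed by the diagonal matrix. *)
Lemma rank_rdiag_indicator n (J : pred 'I_n) :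
  (#|J| <= \rank (rdiag (fun j => (J j)%:R : R)))%N.
Proof.
set A := rdiag _.
pose f (k : 'I_#|J|) : 'I_n := enum_val k.
pose M : 'M[C]_(#|J|, n) := \matrix_(k, j) (f k == j)%:R.
have MA : M *m A = M.
  apply/matrixP => k j; rewrite mul_rdiagE !mxE; case: eqP => [<-|_]; last by rewrite mul0r.
  have -> : J (f k) by have := enum_valP k.
  by rewrite mul1r.
have MM : M *m M^T = 1%:M.
  apply/matrixP => k l; rewrite !mxE (bigD1 (f k)) //= !mxE eqxx mul1r big1 ?addr0.
    by rewrite (inj_eq enum_val_inj) eq_sym.
  by move=> j jk; rewrite !mxE eq_sym (negbTE jk) mul0r.
have /eqP <- : row_free M by apply/row_freeP; exists M^T.
by rewrite -{1}MA mxrankM_maxr.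
Qed.

Lemma psd_rdiag n (h : 'I_n -> R) : (forall i, 0 <= h i) -> psdmx (rdiag h).
Proof.
move=> h0; apply/psdmxP => v; rewrite mxE; apply: sumr_ge0 => i _.
rewrite mul_rdiagE hadjE mulrAC nsqE -rmorphM ler0c.
by rewrite mulr_ge0 // nsq_ge0.
Qed.

Lemma tr_rdiag_mul n (h : 'I_n -> R) (A : 'M[C]_n) :
  complex.Re (\tr (rdiag h *m A)) = \sum_i h i * complex.Re (A i i).
Proof. by rewrite Re_tr; apply: eq_bigr => i _; rewrite rdiag_mulE ReZ. Qed.

(* [V] diagonalises [P D P - (1 - P)]: its nonnegative eigenvalues belong to the
   range of [P], the value [-1] to the range of [1 - P]. *)
Lemma proj_compress_basis n (P D : 'M[C]_n) :
  P^h = P -> P *m P = P -> psdmx D ->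
  exists (V : 'M[C]_n) (J : pred 'I_n) (z : 'I_n -> R),
    [/\ unitary V, V *m P *m V^h = rdiag (fun j => (J j)%:R),
        forall j, 0 <= z j &
        forall j k, J j -> J k -> (V *m D *m V^h) j k = (z j *+ (j == k))%:C].
Proof.
move=> hP PP pD; have hD := psd_adj pD.
pose Q := 1%:M - P.
have PQ : P *m Q = 0 by rewrite mulmxBr mulmx1 PP subrr.
have QQ : Q *m Q = Q by rewrite {1}/Q mulmxBl mul1mx PQ subr0.
have hQ : Q^h = Q by rewrite hadjB hadj_scalar1 hP.
pose M := P *m D *m P.
have pM : psdmx M by have := psd_conj P pD; rewrite hP.
pose Z := M - Q.
have hZ : Z^h = Z by rewrite hadjB hQ (psd_adj pM).
have [uV ZE] := eigdec_spectral hZ.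
set V := spectralmx Z in uV ZE; set ze := eigvals Z in ZE; clearbody V ze.
have VZ (A : 'M[C]_n) : V *m (Z *m A) *m V^h = rdiag ze *m (V *m A *m V^h).
  by rewrite ZE !mulmxA uV mul1mx.
pose p := V *m P *m V^h; pose q := V *m Q *m V^h; pose m := V *m M *m V^h.
have pq : p = 1%:M - q.
  by rewrite /p /q /Q mulmxBr mulmxBl mulmx1 uV subKr.
have conjM A A' := unitary_conjM A A' uV.
have zq : rdiag ze *m q = - q.
  rewrite -VZ mulmxBl QQ /M -(mulmxA _ P) PQ mulmx0 sub0r.
  by rewrite mulmxN mulNmx.
have zp : rdiag ze *m p = m.
  have QP : Q *m P = 0 by rewrite mulmxBl mul1mx PP subrr.
  by rewrite -VZ mulmxBl QP subr0 /M -(mulmxA _ P) PP.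
have pm : psdmx m by apply: psd_conj.
have pp : p *m p = p by rewrite -conjM PP.
have hp : p^h = p by rewrite /p !hadjM hadjK hP mulmxA.
have mE : m = p *m (V *m D *m V^h) *m p by rewrite /m /M !conjM.
have pdef : V *m P *m V^h = p by [].
clearbody p q m.
have ppj j : complex.Re (p j j) = \sum_k nsq (p j k).
  by rewrite -{1}pp sqr_herm_diag.
(* Here [ze j * p j j = m j j >= 0] forces [p j j = 0], and a projection with a zero diagonal entry
   has a zero row there. In [pos], the identity [(ze j + 1) * q j k = 0] kills the rows of [q]. *)
have neg j : ze j < 0 -> forall k, p j k = 0.
  move=> zj.
  have := psd_diag_ge0 j pm; rewrite -zp rdiag_mulE ReZ => h.
  have pj : complex.Re (p j j) = 0.
    apply/eqP; rewrite eq_le; apply/andP; split; last by rewrite ppj sumr_ge0 // => k _; apply: nsq_ge0.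
    by rewrite -(nmulr_rge0 _ zj).
  move=> k; apply: nsq_eq0; move: pj; rewrite ppj => /psumr_eq0P; apply => //.
  by move=> i _; apply: nsq_ge0.
have pos j : 0 <= ze j -> forall k, q j k = 0.
  move=> zj k; have : (ze j)%:C * q j k = - q j k.
    by rewrite -rdiag_mulE zq mxE.
  move: (q j k) => w /eqP; rewrite -subr_eq0 opprK -{2}[w]mul1r -mulrDl mulf_eq0 => /orP[|/eqP //].
  by rewrite eq_complex /= => /andP[/eqP ze1 _]; exfalso; clear -zj ze1; lra.
pose J j := 0 <= ze j.
have pE : p = rdiag (fun j => (J j)%:R).
  apply/matrixP => j k; rewrite rdiagE /J; case: (lerP 0 (ze j)) => [zj|zj].
    by rewrite pq !mxE pos // subr0; case: eqP.
  by rewrite neg // mul0rn.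
exists V, J, (fun j => if J j then ze j else 0); split => //.
  by rewrite pdef.
  by move=> j; case: ifP.
move=> j k Jj Jk; rewrite Jj.
have : m j k = (V *m D *m V^h) j k.
  by rewrite mE pE mul_rdiagE rdiag_mulE Jj Jk mul1r mulr1.
move=> <-; rewrite -zp rdiag_mulE pE rdiagE Jj.
by rewrite -rmorphM /=; case: eqP; rewrite ?mulr1 ?mulr0.
Qed.

(** Applies [proj_compress_basis] to [P] and [B^2]. With [Y] the operator inside the projection,
    [P Y P <= 0] read on the diagonal gives the collision bound, and the range of [1 - P] lies in
    the support of [B], which limits the number of indices off [J]. *)
Lemma nonpos_proj_basis (X : finType) n (tau : X -> 'M[C]_n) (c : R) :
  (forall x, psdmx (tau x)) -> \tr (\sum_x tau x) = 1 ->
  let B := \sum_x tau x in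
  let P := nonpos_proj (\sum_x tau x *m tau x - c%:C *: (B *m B)) in
  exists (V : 'M[C]_n) (J : pred 'I_n) (z : 'I_n -> R),
    [/\ unitary V,
        forall j, 0 <= z j,
        forall j k, J j -> J k -> (V *m (B *m B) *m V^h) j k = (z j *+ (j == k))%:C,
        forall j, J j ->
          complex.Re ((V *m (\sum_x tau x *m tau x) *m V^h) j j) <= c * z j &
        complex.Re (\tr (P *m B)) = \sum_(j | J j) complex.Re ((V *m B *m V^h) j j)
        /\ (#|[pred j | ~~ J j]| <= \rank B)%N].
Proof.
move=> pt tB B P.
have pB : psdmx B by apply: psd_sum.
have hB := psd_adj pB.
have hT : (\sum_x tau x *m tau x)^h = \sum_x tau x *m tau x.
  rewrite hadj_sum; apply: eq_bigr => x _; by rewrite hadjM (psd_adj (pt x)).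
set R2 := \sum_x tau x *m tau x in P hT *.
pose Y := R2 - c%:C *: (B *m B).
have hY : Y^h = Y by rewrite hadjB hT hadjZ hadjM hB.
have eY := eigdec_spectral hY.
have PE := mxfun_eigdec (fun l => if l <= 0 then 1 else 0) eY.
rewrite -/(nonpos_proj Y) -/P /comp in PE.
case: eY; set U := spectralmx Y in PE *; set l := eigvals Y in PE * => uU YE.
set o := fun x => if l x <= 0 then 1 else 0 in PE.
have YD : Y = R2 - c%:C *: (B *m B) by [].
have BD : B = \sum_x tau x by [].
have R2D : R2 = \sum_x tau x *m tau x by [].
clearbody P U l Y R2 B.
have UU (h h' : 'I_n -> R) : U^h *m rdiag h *m U *m (U^h *m rdiag h' *m U) =
    U^h *m rdiag (fun i => h i * h' i) *m U.
  by rewrite -rdiagM !mulmxA -(mulmxA (U^h *m rdiag h) U) uU mulmx1.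
have Ueq (h h' : 'I_n -> R) : h =1 h' -> U^h *m rdiag h *m U = U^h *m rdiag h' *m U.
  move=> hh; congr (_ *m diag_mx _ *m _); by apply/rowP => i; rewrite !mxE hh.
have hP : P^h = P by rewrite PE !hadjM hadjK hadj_rdiag mulmxA.
have PP : P *m P = P.
  by rewrite PE UU; apply: Ueq => i; rewrite /o; case: ifP; rewrite ?mulr1 ?mulr0.
have pD : psdmx (B *m B).
  have := psd_conj B (psd_rdiag (fun _ : 'I_n => ler01)).
  have -> : rdiag (fun=> 1) = 1%:M :> 'M[C]_n.
    by apply/matrixP => i j; rewrite rdiagE !mxE; case: eqP.
  by rewrite mulmx1 hB.
have [V [J [z [uV VP z0 hz]]]] := proj_compress_basis hP PP pD.
have conjM A A' := unitary_conjM A A' uV.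
exists V, J, z; split => //.
- move=> j Jj.
  have PYP : psdmx (- (P *m Y *m P)).
    rewrite PE YE !UU.
    have -> : - (U^h *m rdiag (fun i => o i * l i * o i) *m U) =
       U^h *m rdiag (fun i => - (o i * l i * o i)) *m U.
      rewrite -mulNmx -mulmxN; congr (_ *m _ *m _); apply/matrixP => a b.
      by rewrite mxE !rdiagE mulNrn rmorphN.
    have := psd_conj (U^h) (psd_rdiag (h := fun i => - (o i * l i * o i)) _).
    rewrite hadjK; apply => i; rewrite /o; case: ifP => hl; rewrite ?mul1r ?mulr1 ?mul0r ?oppr0 //.
    by rewrite oppr_ge0.
  have := psd_diag_ge0 j (psd_conj V PYP).
  rewrite mulmxN mulNmx mxE ReN !conjM VP mul_rdiagE rdiag_mulE Jj mul1r mulr1.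
  rewrite YD mulmxBr mulmxBl mxE [X in _ + X]mxE -scalemxAr -scalemxAl [X in _ - X]mxE.
  rewrite ReD ReN ReZ hz // eqxx mulr1n /=; lra.
- split.
  + have -> : \tr (P *m B) = \tr (rdiag (fun j => (J j)%:R) *m (V *m B *m V^h)).
      by rewrite -VP -conjM [RHS]mxtrace_mulC (mulmxA (V^h) V) (unitary_mulVr uV) mul1mx.
    rewrite tr_rdiag_mul [RHS]big_mkcond; apply: eq_bigr => j _.
    by case: (J j); rewrite ?mul1r ?mul0r.
  + pose Q := 1%:M - P.
    have VQ : V *m Q *m V^h = rdiag (fun j => (~~ J j)%:R).
      rewrite mulmxBr mulmxBl mulmx1 uV VP; apply/matrixP => i j.
      by rewrite !mxE -[LHS]/(_ - _); case: eqP => _; case: (J i); rewrite /= ?mulr1n ?mulr0n ?subrr ?subr0.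
    (* The projection [P] contains the kernel of [Y], so on [Q] the eigenvalues are strictly
       positive and can be inverted: [Q] is a multiple of [Y]. *)
    have QY : (Q <= Y)%MS.
      have -> : Q = U^h *m rdiag (fun i => if l i <= 0 then 0 else (l i)^-1) *m U *m Y.
        rewrite {1}YE UU /Q PE -(unitary_mulVr uU) -{1}[U^h]mulmx1 -mulmxBl -mulmxBr.
        congr (_ *m _ *m _); apply/matrixP => i j; rewrite !mxE /o.
        case: eqP => _; rewrite ?mulr1n ?mulr0n ?subrr //.
        case: (lerP (l i) 0) => li; first by rewrite subrr mul0r.
        by rewrite mulVf ?gt_eqF // subr0.
      exact: submxMl.
    have YB : (Y <= B)%MS.
      rewrite YD; apply: addmx_sub.
        rewrite R2D; apply: summx_sub => x _; rewrite BD; apply: submx_trans (psd_sub_sum x pt).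
        exact: submxMl.
      by rewrite eqmx_opp; apply: scalemx_sub; apply: submxMl.
    apply: leq_trans (mxrankS (submx_trans QY YB)).
    apply: leq_trans (rank_rdiag_indicator _) _.
    rewrite -VQ; apply: leq_trans (mxrankM_maxl _ _) _.
    exact: mxrankM_maxr.
Qed.

End Projection.

(** * Passage to the supremum and assembly of the bound *)

Section Final.
Variable R : realType.
Local Notation C := R[i].
Local Notation "A ^h" := (hadj A).

Lemma tensmxZr m n p q (c : C) (A : 'M[C]_(m, n)) (B : 'M[C]_(p, q)) :
  A *t (c *: B) = c *: (A *t B).
Proof. by apply/matrixP => i j; rewrite !mxE mulrCA. Qed.

Lemma tensmxZl m n p q (c : C) (A : 'M[C]_(m, n)) (B : 'M[C]_(p, q)) :
  (c *: A) *t B = c *: (A *t B).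
Proof. by apply/matrixP => i j; rewrite !mxE mulrA. Qed.

Lemma tensmx_sumr (I : finType) m n p q (A : 'M[C]_(m, n)) (F : I -> 'M[C]_(p, q)) :
  A *t (\sum_i F i) = \sum_i A *t F i.
Proof.
apply/matrixP => i j; rewrite mxE !summxE mulr_sumr.
by apply: eq_bigr => k _; rewrite mxE.
Qed.

Lemma blockdiagZ (T : finType) n (c : C) (A : T -> 'M[C]_n) :
  c *: blockdiag A = blockdiag (fun t => c *: A t).
Proof. by rewrite scaler_sumr; apply: eq_bigr => t _; rewrite tensmxZr. Qed.

Lemma blockdiag_cst (T : finType) n (A : 'M[C]_n) :
  blockdiag (fun _ : T => A) = (1%:M : 'M[C]_#|T|) *t A.
Proof.
apply: eq_mx_tens => i j k l; rewrite blockdiagE tensmxE !mxE.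
by case: eqP => _; rewrite ?mul1r ?mul0r.
Qed.

(** For [q > 0] the hypothesis bounds every [l] in [A] by [log2 (t / q)], hence also the supremum,
    attained or not. An empty [A] has supremum [-oo], which makes the right side [+oo]. *)
Lemma le_pow2e_sup (t q : R) (A : set R) : 0 < t ->
  (forall l, A l -> q <= t * 2 `^ (- l)) ->
  (q%:E <= t%:E * pow2e (- ereal_sup [set (l%:E)%E | l in A]))%E.
Proof.
move=> t0 hA; have pge0 (u : \bar R) : (0 <= pow2e u)%E.
  by case: u => [r||] //=; rewrite lee_fin powR_ge0.
have [q0|q0] := lerP q 0.
  apply: (@le_trans _ _ 0%E); first by rewrite lee_fin.
  by apply: mule_ge0 => //; rewrite lee_fin ltW.
have l2 := ln2_gt0 R.
pose m := (ln t - ln q) / ln 2.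
have : (ereal_sup [set (l%:E)%E | l in A] <= m%:E)%E.
  apply: ge_ereal_sup => _ [l Al <-]; rewrite lee_fin /m ler_pdivlMr //.
  have := hA l Al => /(ln_le_pos q0); rewrite lnM ?posrE ?powR_gt0 // ln_powR.
  by lra.
case: (ereal_sup _) => [r||] /=.
- rewrite !lee_fin /m ler_pdivlMr // => rm.
  rewrite -ler_ln ?posrE ?mulr_gt0 ?powR_gt0 // lnM ?posrE ?powR_gt0 // ln_powR.
  by lra.
- by rewrite leye_eq.
- by rewrite gt0_muley ?lte_fin // leey.
Qed.

(** Conjugation by [V] preserves all spectra, so [entropy_defect_le] may be applied in the adapted
    basis. The scalar lemmas then replace the actual defect [e] by [eps], and [b <= 1] simplifies
    the collision term. *)
Lemma hash_relent_le (X S G : finType) n (gf : G -> {ffun X -> S})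
    (tau : X -> 'M[C]_n) (c eps : R) :
  (forall x, psdmx (tau x)) -> \tr (\sum_x tau x) = 1 ->
  (0 < #|S|)%N -> (0 < #|G|)%N -> two_universal R gf -> 0 <= c -> 0 <= eps ->
  let B := \sum_x tau x in
  1 - eps <= complex.Re (\tr (nonpos_proj
      (\sum_x tau x *m tau x - c%:C *: (B *m B)) *m B)) ->
  ln #|S|%:R
     + #|G|%:R^-1 * (\sum_g \sum_s \sum_i
         eigvals (hash_sum gf tau g s) i * ln (eigvals (hash_sum gf tau g s) i))
     - \sum_i eigvals B i * ln (eigvals B i) <=
  eps * ln (\rank B * #|S|)%:R + ln 2 * eta0 eps + eps + Num.sqrt eps
    + #|S|%:R * c.
Proof.
move=> pt tB S0 G0 tu c0 eps0 B hlev.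
have [V [J [z [uV z0 hz hc [hJ hd]]]]] := nonpos_proj_basis c pt tB.
rewrite -/B in hz hJ hd; rewrite hJ in hlev; move: hlev => {hJ} hlev.
have pB : psdmx B by apply: psd_sum.
pose tau' x := V *m tau x *m V^h.
have pt' x : psdmx (tau' x) by apply: psd_conj.
have sB : \sum_x tau' x = V *m B *m V^h by rewrite mulmx_sumr mulmx_suml.
have conjM A A' := unitary_conjM A A' uV.
have sT : \sum_x tau' x *m tau' x = V *m (\sum_x tau x *m tau x) *m V^h.
  by rewrite mulmx_sumr mulmx_suml; apply: eq_bigr => x _; rewrite conjM.
have eB := eigdec_spectral (psd_adj pB).
have r0 i := eigdec_ge0 i pB eB.
have r1 : \sum_i eigvals B i = 1 by apply: (@complexI R); rewrite -(tr_eigdec eB) tB.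
have pw g s : psdmx (hash_sum gf tau g s) by apply: psd_sum.
have ew g s := eigdec_spectral (psd_adj (pw g s)).
have hw g s : hash_sum gf tau' g s = V *m hash_sum gf tau g s *m V^h.
  by rewrite mulmx_sumr mulmx_suml.
(* An eigenvalue is at most the trace of its block, and for fixed [g] the traces of the blocks add
   up to [1]. *)
have a01 g s i : 0 <= eigvals (hash_sum gf tau g s) i <= 1.
  have a0 s' j := eigdec_ge0 j (pw g s') (ew g s').
  rewrite a0 /=; apply: (@le_trans _ _ (\sum_s' complex.Re (\tr (hash_sum gf tau g s')))).
    rewrite (bigD1 s) //= (tr_eigdec (ew g s)) /= (bigD1 i) //= -addrA lerDl.
    apply: addr_ge0; first by apply: sumr_ge0.
    by apply: sumr_ge0 => s' _; apply: psd_tr_ge0.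
  by rewrite -Re_sum -tr_sum (sum_fibers gf g) tB.
have d0 : (0 < \rank B)%N by apply: tr1_rank_gt0.
have tB' : \tr (\sum_x tau' x) = 1.
  by rewrite sB mxtrace_mulC mulmxA (unitary_mulVr uV) mul1mx.
have pB' : psdmx (\sum_x tau' x) by apply: psd_sum.
set e := \sum_(j | ~~ J j) complex.Re ((\sum_x tau' x) j j).
set b := \sum_(j | J j) Num.sqrt (z j).
have eJ : \sum_(j | J j) complex.Re ((\sum_x tau' x) j j) = 1 - e.
  have : complex.Re (\tr (\sum_x tau' x)) = 1 by rewrite tB'.
  by rewrite Re_tr (bigID J) /= -/e; lra.
have e0 : 0 <= e by apply: sumr_ge0 => j _; apply: psd_diag_ge0.
have e1 : e <= 1.
  have : 0 <= 1 - e by rewrite -eJ; apply: sumr_ge0 => j _; apply: psd_diag_ge0.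
  by lra.
have ee : e <= eps by move: hlev; rewrite -sB eJ; lra.
have b0 : 0 <= b by apply: sumr_ge0 => j _; apply: sqrtr_ge0.
have b2 : b ^+ 2 <= 1 - e.
  rewrite -eJ; apply: sum_sqrt_sqr_le => // j k Jj Jk.
  by rewrite sB -conjM hz.
have main k : 0 < k ->
  ln #|S|%:R
     + #|G|%:R^-1 * (\sum_g \sum_s \sum_i
         eigvals (hash_sum gf tau g s) i * ln (eigvals (hash_sum gf tau g s) i))
     - \sum_i eigvals B i * ln (eigvals B i) <=
  (e * ln ((\rank B)%:R * #|S|%:R) - e * ln e + 2 * (b - (1 - e)) + e
    + #|S|%:R * c * b) + k * n.+1%:R.
  move=> k0.
  apply: (entropy_defect_le pt' (gf := gf) (Us := fun g s => spectralmx (hash_sum gf tau g s) *m V^h)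
    (U := spectralmx B *m V^h) (c := c)) => //.
  - by move=> g s; rewrite hw; apply: eigdec_conj.
  - by rewrite sB; apply: eigdec_conj.
  - by move=> j Jj; rewrite sB -conjM hz // eqxx mulr1n.
  - by move=> j Jj; rewrite sT; apply: hc.
have {main} : ln #|S|%:R
     + #|G|%:R^-1 * (\sum_g \sum_s \sum_i
         eigvals (hash_sum gf tau g s) i * ln (eigvals (hash_sum gf tau g s) i))
     - \sum_i eigvals B i * ln (eigvals B i) <=
  (e * ln ((\rank B)%:R * #|S|%:R) - e * ln e + 2 * (b - (1 - e)) + e
    + #|S|%:R * c * b).
  (* The limit of vanishing shift: [k / n.+1] makes the error exactly [k]. *)
  apply/ler_addgt0Pr => k k0.
  have := main (k / n.+1%:R) (divr_gt0 k0 (ltr0Sn _ _)).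
  by rewrite divfK // pnatr_eq0.
move=> /le_trans; apply; rewrite -natrM.
have lnd : 0 <= ln (\rank B * #|S|)%:R :> R.
  by apply: ln_ge0; rewrite ler1n muln_gt0 d0.
have h1 := ler_wpM2r lnd ee.
have h2 := @eta0_mono R e eps (introT andP (conj e0 e1)) ee.
have h3 := sqrt_defect_le (introT andP (conj e0 e1)) b0 b2.
have h4 : Num.sqrt e <= Num.sqrt eps by rewrite ler_sqrt.
have b1 : b <= 1 by rewrite -(@ler_pXn2r _ 2) ?nnegrE // expr1n; lra.
have h5 : #|S|%:R * c * b <= #|S|%:R * c.
  by apply: ler_piMr => //; apply: mulr_ge0.
by lra.
Qed.

End Final.

Theorem theorem1 (R : realType) (X S G : finType) (n : nat)
  (p : X -> R) (rho : X -> 'M[R[i]]_n) (gf : G -> {ffun X -> S}) (eps : R) :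
  (forall x, 0 <= p x) -> \sum_(x : X) p x = 1 ->
  (forall x, density (rho x)) ->
  (0 < #|G|)%N -> injective gf -> two_universal R gf ->
  0 <= eps ->
  let rhoXB : 'M[R[i]]_(#|X| * n) :=
    \sum_(x : X) (p x)%:C *: (ket_proj x *t rho x) in
  let rhoB : 'M[R[i]]_n := \sum_(x : X) (p x)%:C *: rho x in
  let psg (s : S) (g : G) : R := \sum_(x : X | gf g x == s) p x in
  let rhosg (s : S) (g : G) : 'M[R[i]]_n :=
    ((psg s g)^-1)%:C *: \sum_(x : X | gf g x == s) (p x)%:C *: rho x in
  let rhoSGB : 'M[R[i]]_(#|S| * (#|G| * n)) :=
    \sum_(s : S) \sum_(g : G)
      (psg s g)%:C *: (ket_proj s *t (((#|G|%:R)^-1)%:C *: ket_proj g *t rhosg s g)) in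
  let sigmaSGB : 'M[R[i]]_(#|S| * (#|G| * n)) :=
    ((#|S|%:R)^-1)%:C *: (1%:M : 'M_#|S|)
      *t ((((#|G|%:R)^-1)%:C *: (1%:M : 'M_#|G|)) *t rhoB) in
  let d : nat := \rank rhoB in
  let delta : \bar R := ((#|S|%:R)%:E * pow2e (- Rcoll eps rhoXB rhoB))%E in
  ((relent rhoSGB sigmaSGB)%:E <=
     (eps * log2 (d * #|S|)%:R + eta0 eps)%:E
     + (delta + (eps + Num.sqrt eps)%:E) * ((ln (2 : R))^-1)%:E)%E.
Proof.
move=> p0 p1 drho G0 _ tu eps0; lazy beta zeta.
set rhoXB := \sum_x (p x)%:C *: (ket_proj x *t rho x).
set rhoB := \sum_x (p x)%:C *: rho x.
pose psg s g := \sum_(x | gf g x == s) p x.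
pose rhosg s g := ((psg s g)^-1)%:C *: \sum_(x | gf g x == s) (p x)%:C *: rho x.
set rhoSGB := \sum_s _; set sigmaSGB := _ *t _.
set delta := (_%:E * _)%E; set d := \rank rhoB.
pose tau x := (p x)%:C *: rho x.
have pt x : psdmx (tau x) by apply: psdZ => //; case: (drho x).
have tB : \tr (\sum_x tau x) = 1.
  rewrite tr_sum; under eq_bigr => x _ do rewrite mxtraceZ (proj2 (drho x)) mulr1.
  by rewrite -realC_sum p1.
(* Total probability [1] makes [X] nonempty, and any [gf g x] is then an element of [S]. *)
have S0 : (0 < #|S|)%N.
  have [x _|X0] := pickP (pred_of_simpl (@predT X)).
    have [g _|G00] := pickP (pred_of_simpl (@predT G)).
      by apply/card_gt0P; exists (gf g x).
    by move: G0; rewrite (eq_card0 G00).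
  by move/eqP: p1; rewrite big_pred0 // eq_sym oner_eq0.
have XBE : rhoXB = blockdiag tau.
  by apply: eq_bigr => x _; rewrite tensmxZr.
have R2E : ptrace1 (rhoXB *m rhoXB) = \sum_x tau x *m tau x.
  by rewrite XBE blockdiagM ptrace1_blockdiag.
have sgE s g : (psg s g)%:C *: rhosg s g = hash_sum gf tau g s.
  (* If [psg s g = 0], every [p x] in the fibre is zero, so both sides vanish whatever the default
     inverse is. *)
  rewrite /rhosg scalerA -rmorphM /=; have [psg0|psgn0] := eqVneq (psg s g) 0.
    have px x : gf g x == s -> p x = 0.
      by move=> gx; have /psumr_eq0P := psg0; apply.
    have tau0 x : gf g x == s -> (p x)%:C *: rho x = 0.
      by move=> gx; rewrite px // scale0r.
    by rewrite /hash_sum !big1 // scaler0.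
  by rewrite mulfV // scale1r.
have SGBE : rhoSGB = blockdiag (fun s => blockdiag (fun g =>
    (#|G|%:R^-1)%:C *: hash_sum gf tau g s)).
  apply: eq_bigr => s _; rewrite tensmx_sumr; apply: eq_bigr => g _.
  rewrite -/(psg s g) -/(rhosg s g) -sgE; move: (rhosg s g) => w.
  by rewrite tensmxZl !tensmxZr !scalerA mulrC.
have sigE : sigmaSGB = blockdiag (fun s : S => blockdiag (fun g : G =>
    (#|S|%:R^-1 * #|G|%:R^-1)%:C *: rhoB)).
  rewrite /sigmaSGB !tensmxZl -!blockdiag_cst blockdiagZ.
  apply: eq_blockdiag => s; rewrite !blockdiagZ; apply: eq_blockdiag => g.
  by rewrite scalerA -rmorphM.
have relE := @relent_hash R S G n (fun s g => hash_sum gf tau g s) rhoB S0 G0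
  (fun s g => psd_sum _ pt) (psd_sum _ pt) tB (fun g => sum_fibers gf g tau).
rewrite SGBE sigE relE; set D := _ - _.
have l2 := ln2_gt0 R.
have d0 : (0 < d)%N by apply: tr1_rank_gt0.
have dS0 : (0 : R) < (d * #|S|)%:R by rewrite ltr0n muln_gt0 d0.
(* In nats and with [delta] isolated, the bound need only be checked at each admissible [l], where
   [hash_relent_le] is used with [c = 2^(-l)]. *)
have : ((D - (eps * ln (d * #|S|)%:R + ln 2 * eta0 eps + eps + Num.sqrt eps))%:E
    <= delta)%E.
  apply: le_pow2e_sup; first by rewrite ltr0n.
  move=> l /=; rewrite R2E => hl; rewrite lerBlDl.
  by apply: hash_relent_le hl => //; apply: powR_ge0.
rewrite /log2 dS0; move: (ln _) (eta0 eps) (Num.sqrt eps) delta => ld et sq delta.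
(* A finite [delta] leaves a real inequality divided by [ln 2], [+oo] makes the bound trivial, and
   [-oo] contradicts the inequality just obtained. *)
clearbody D; clear - l2; case: delta => [r|_|//].
  rewrite !lee_fin => h; rewrite ler_pdivrMr // mulrDl -mulrA mulVf ?gt_eqF // mulr1.
  rewrite [(_ + et) * _]mulrDl mulrA divfK ?gt_eqF //.
  by rewrite [et * _]mulrC; lra.
by rewrite addye // gt0_mulye ?lte_fin ?invr_gt0 // addey // leey.
Qed.
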